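(* Let $\Lambda$ be a basic Artin algebra, let $e$ be a primitive idempotent of $\Lambda$, let $S_e = \Lambda e/(\mathrm{rad}\,\Lambda) e$ be the simple left $\Lambda$-module supported at $e$, and let $\Gamma = (1-e)\Lambda(1-e)$. Assume that $\mathrm{pd}_\Lambda S_e$ is finite. Then $\mathrm{findim}\,\Gamma \le 2\,\mathrm{findim}\,\Lambda - \ell$ for some integer $\ell$ with $1 \le \ell \le \mathrm{pd}_\Lambda S_e$.
   Context: All modules are finitely generated left modules; $\mathrm{rad}\,\Lambda$ is the Jacobson radical and $\mathrm{pd}$ denotes projective dimension. For an Artin algebra $A$, the (little) finitistic dimension is $\mathrm{findim}\,A = \sup\{\mathrm{pd}_A M \mid M \text{ a finitely generated left } A\text{-module with } \mathrm{pd}_A M<\infty\}$ (possibly $\infty$).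
   Formalization: The projective dimension of S_e is additionally assumed to be at least 1; if it is 0 (e.g. Λ a field, e = 1), no integer ℓ with 1 ≤ ℓ ≤ pd S_e exists and the claim as written fails. *)

(* Defs.v *)
From HB Require Import structures.
From mathcomp Require Import all_boot all_order all_algebra.
From mathcomp Require Import generic_quotient ring_quotient.
From mathcomp Require Import boolp classical_sets constructive_ereal.
Set Implicit Arguments.
Unset Strict Implicit.
Unset Printing Implicit Defensive.
Import Order.TTheory GRing.Theory Num.Theory.
Local Open Scope classical_set_scope.
Local Open Scope ring_scope.

(* Modules are left modules (lmodType).  A ring R is a left module over itself
   through R^o, so a left ideal of R is a submodule of R^o.  Rings are only
   required to be pzRingType (0 = 1 allowed), because a corner ring fRf is the
   zero ring when f = 0. *)

Record submodule (R : pzRingType) (M : lmodType R) := Submodule {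
  submod_set :> M -> Prop;
  submod0 : submod_set 0;
  submodD : forall x y, submod_set x -> submod_set y -> submod_set (x + y);
  submodZ : forall a x, submod_set x -> submod_set (a *: x)
}.

Section SubmoduleAsModule.
Variables (R : pzRingType) (M : lmodType R) (N : submodule M).

Definition submod_pred : pred M := fun x => `[< N x >].

Lemma submod_closed_pred : submod_closed submod_pred.
Proof.
split=> [|a x y /asboolP Nx /asboolP Ny]; apply/asboolP; first exact: submod0.
by apply: submodD => //; apply: submodZ.
Qed.

HB.instance Definition _ :=
  GRing.isSubmodClosed.Build R M submod_pred submod_closed_pred.

Record submod := Submod { submod_val : M; _ : submod_pred submod_val }.

HB.instance Definition _ := [isSub for submod_val].
HB.instance Definition _ := [Choice of submod by <:].
HB.instance Definition _ :=
  GRing.SubChoice_isSubLmodule.Build R M submod_pred submod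
    (GRing.subsemimodClosedP _).

End SubmoduleAsModule.

Section QuotientModule.
Variables (R : pzRingType) (M : lmodType R) (N : submodule M).
Local Open Scope quotient_scope.

Lemma submod_zmod_closed : zmod_closed (submod_pred N).
Proof.
split=> [|x y /asboolP Nx /asboolP Ny]; apply/asboolP; first exact: submod0.
by apply: submodD => //; rewrite -scaleN1r; apply: submodZ.
Qed.

Definition submod_zpred : M -> bool := submod_pred N.

HB.instance Definition _ :=
  GRing.isZmodClosed.Build M submod_zpred submod_zmod_closed.

Definition submod_zmod := GRing.ZmodClosed.clone M submod_zpred _.

Definition quotmod : Type := Quotient.quot submod_zmod.

HB.instance Definition _ := GRing.Zmodule.on quotmod.

Definition quotmod_pi : M -> quotmod := \pi_(Quotient.quot submod_zmod).

Definition quotmod_scale (a : R) (x : quotmod) : quotmod :=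
  quotmod_pi (a *: repr (x : Quotient.quot submod_zmod)).

Lemma quotmod_piE x y : quotmod_pi x = quotmod_pi y <-> N (x - y).
Proof.
rewrite /quotmod_pi; split=> [/eqP|Nxy].
  by rewrite -Quotient.idealrBE => /asboolP.
by apply/eqP; rewrite -Quotient.idealrBE; apply/asboolP.
Qed.

Lemma quotmod_piD : {morph quotmod_pi : x y / x + y}.
Proof. by move=> x y; rewrite /quotmod_pi raddfD. Qed.

Lemma quotmod_scale_pi a x : quotmod_scale a (quotmod_pi x) = quotmod_pi (a *: x).
Proof.
apply/quotmod_piE; rewrite -scalerBr; apply: submodZ.
by apply/quotmod_piE; rewrite /quotmod_pi reprK.
Qed.

Lemma quotmod_piP (x : quotmod) : exists y, x = quotmod_pi y.
Proof. by exists (repr (x : Quotient.quot submod_zmod)); rewrite /quotmod_pi reprK. Qed.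

Lemma quotmod_scaleA a b x :
  quotmod_scale a (quotmod_scale b x) = quotmod_scale (a * b) x.
Proof. by case: (quotmod_piP x) => y ->; rewrite !quotmod_scale_pi scalerA. Qed.

Lemma quotmod_scale1 : left_id 1 quotmod_scale.
Proof.
by move=> x; case: (quotmod_piP x) => y ->; rewrite quotmod_scale_pi scale1r.
Qed.

Lemma quotmod_scaleDr : right_distributive quotmod_scale +%R.
Proof.
move=> a x y; case: (quotmod_piP x) (quotmod_piP y) => {}x -> [{}y ->].
by rewrite -quotmod_piD !quotmod_scale_pi scalerDr quotmod_piD.
Qed.

Lemma quotmod_scaleDl x : {morph quotmod_scale^~ x : a b / a + b}.
Proof.
move=> a b; case: (quotmod_piP x) => {}x ->.
by rewrite !quotmod_scale_pi scalerDl quotmod_piD.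
Qed.

HB.instance Definition _ := GRing.Zmodule_isLmodule.Build R quotmod
  quotmod_scaleA quotmod_scale1 quotmod_scaleDr quotmod_scaleDl.

End QuotientModule.

Section Modules.
Variable R : pzRingType.
Implicit Types M N P : lmodType R.

Definition fin_gen M := exists (n : nat) (g : 'I_n -> M),
  forall x, exists c : 'I_n -> R, x = \sum_(i < n) c i *: g i.

Definition lmod_iso M N := exists f : {linear M -> N}, bijective f.

Definition projective P :=
  forall M N (g : {linear M -> N}) (f : {linear P -> N}),
    (forall y, exists x, g x = y) ->
    exists h : {linear P -> M}, forall x, g (h x) = f x.

(* There is an exact sequence 0 -> P_n -> ... -> P_1 -> P_0 -> M -> 0 with all
   P_i finitely generated projective. *)
Definition proj_resolution M (n : nat) :=
  exists (P : nat -> lmodType R) (d : forall i, {linear P i.+1 -> P i})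
         (eps : {linear P 0 -> M}),
    [/\ forall i, fin_gen (P i) /\ projective (P i),
        forall y, exists x, eps x = y,
        eps @^-1` [set 0] = range (d 0),
        forall i, d i @^-1` [set 0] = range (d i.+1)
      & forall i, (n < i)%N -> forall x : P i, x = 0].

(* Values in int extended with +oo and -oo; pd M = +oo when no finite
   resolution exists, and the zero module has pd 0. *)
Definition pd M : \bar int :=
  infimum +oo%E [set (n%:Z)%:E | n in [set n | proj_resolution M n]].

Definition findim : \bar int :=
  supremum -oo%E
    [set v | exists M, [/\ fin_gen M, (pd M < +oo)%E & v = pd M]].

Definition artinian :=
  forall I : nat -> submodule R^o, (forall n x, I n.+1 x -> I n x) ->
    exists m, forall n, (m <= n)%N -> forall x, I n x <-> I m x.

Definition maximal_left_ideal (I : submodule R^o) :=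
  ~ I 1 /\ forall J : submodule R^o, (forall x, I x -> J x) ->
    J 1 \/ forall x, J x -> I x.

Definition rad_set : set R^o :=
  [set x | forall I : submodule R^o, maximal_left_ideal I -> I x].

Lemma rad_set0 : rad_set 0.
Proof. by move=> I _; apply: submod0. Qed.

Lemma rad_setD x y : rad_set x -> rad_set y -> rad_set (x + y).
Proof. by move=> rx ry I mI; apply: submodD; [apply: rx | apply: ry]. Qed.

Lemma rad_setZ a x : rad_set x -> rad_set (a *: x).
Proof. by move=> rx I mI; apply: submodZ; apply: rx. Qed.

Definition rad : submodule R^o := Submodule rad_set0 rad_setD rad_setZ.

Definition full_ideal : submodule R^o :=
  @Submodule R R^o setT I (fun _ _ _ _ => I) (fun _ _ _ => I).

Section RightTranslate.
Variables (I : submodule R^o) (e : R).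

Definition ideal_mul_set : set R^o := [set x | exists2 r : R, I r & x = r * e].

Lemma ideal_mul_set0 : ideal_mul_set 0.
Proof. by exists 0; [apply: submod0 | rewrite mul0r]. Qed.

Lemma ideal_mul_setD x y :
  ideal_mul_set x -> ideal_mul_set y -> ideal_mul_set (x + y).
Proof.
case=> r Ir -> [s Is ->]; exists (r + s); first exact: (submodD Ir Is).
by rewrite mulrDl.
Qed.

Lemma ideal_mul_setZ a x : ideal_mul_set x -> ideal_mul_set (a *: x).
Proof.
case=> r Ir ->; exists (a * r); first exact: (submodZ a Ir).
by rewrite -mulrA.
Qed.

(* The left ideal I e = { r e | r in I }. *)
Definition ideal_mul : submodule R^o :=
  Submodule ideal_mul_set0 ideal_mul_setD ideal_mul_setZ.

End RightTranslate.

Definition principal (e : R) : submodule R^o := ideal_mul full_ideal e.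

Section SubmoduleInSubmodule.
Variables (M : lmodType R) (N K : submodule M).

Definition submod_in_set : set (submod N) := [set x | K (submod_val x)].

Lemma submod_in_set0 : submod_in_set 0.
Proof. exact: submod0. Qed.

Lemma submod_in_setD x y :
  submod_in_set x -> submod_in_set y -> submod_in_set (x + y).
Proof. exact: submodD. Qed.

Lemma submod_in_setZ a x : submod_in_set x -> submod_in_set (a *: x).
Proof. exact: submodZ. Qed.

(* K, intersected with N, as a submodule of N. *)
Definition submod_in : submodule (submod N) :=
  Submodule submod_in_set0 submod_in_setD submod_in_setZ.

End SubmoduleInSubmodule.

(* S_e = R e / (rad R) e *)
Definition top_simple (e : R) : lmodType R :=
  quotmod (submod_in (principal e) (ideal_mul rad e)).

Definition idem (e : R) := e * e = e.

Definition primitive_idem (e : R) :=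
  [/\ idem e, e <> 0 &
      forall a b : R, idem a -> idem b -> a * b = 0 -> b * a = 0 ->
        e = a + b -> a = 0 \/ b = 0].

Lemma primitive_idem_idem e : primitive_idem e -> idem e.
Proof. by case. Qed.

Lemma idemC e : idem e -> idem (1 - e).
Proof. by rewrite /idem mulrBr mulr1 mulrBl mul1r => ->; rewrite subrr subr0. Qed.

Definition primitive_decomposition n (f : 'I_n -> R) :=
  [/\ forall i, primitive_idem (f i),
      forall i j, i != j -> f i * f j = 0
    & \sum_(i < n) f i = 1].

(* R = R f_1 + ... + R f_n with indecomposable, pairwise nonisomorphic
   summands; for Artin algebras the choice of the f_i does not matter. *)
Definition basic := forall n (f : 'I_n -> R), primitive_decomposition f ->
  forall i j, i != j -> ~ lmod_iso (submod (principal (f i)))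
                                   (submod (principal (f j))).

End Modules.

Definition artin_algebra (k : comNzRingType) (A : algType k) :=
  artinian k /\ fin_gen A.

(* fRf, as the set of x with f x f = x; its unit is f. *)
Section CornerRing.
Variables (R : pzRingType) (f : R).

Record corner_elt := Corner {
  corner_val : R;
  cornerP : f * corner_val * f == corner_val
}.

HB.instance Definition _ := [isSub for corner_val].
HB.instance Definition _ := [Choice of corner_elt by <:].

Definition corner_pred : pred R := fun x => f * x * f == x.

Lemma corner_zmod_closed : zmod_closed corner_pred.
Proof.
split=> [|x y /eqP hx /eqP hy]; apply/eqP; first by rewrite mulr0 mul0r.
by rewrite mulrBr mulrBl hx hy.
Qed.

HB.instance Definition _ :=
  GRing.SubChoice_isSubZmodule.Build R corner_pred corner_elt corner_zmod_closed.

(* The proof argument provides the laws of the unit f. *)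
Definition corner of idem f : Type := corner_elt.

Hypothesis hf : idem f.

HB.instance Definition _ := GRing.Zmodule.on (corner hf).

Lemma corner_mull (x : corner_elt) : f * corner_val x = corner_val x.
Proof. by rewrite -(eqP (cornerP x)) !mulrA hf. Qed.

Lemma corner_mulr (x : corner_elt) : corner_val x * f = corner_val x.
Proof. by rewrite -(eqP (cornerP x)) -!mulrA hf. Qed.

Lemma corner_one_subproof : f * f * f == f.
Proof. by rewrite !hf. Qed.

Definition corner_one : corner hf := Corner corner_one_subproof.

Lemma corner_mul_subproof (x y : corner_elt) :
  f * (corner_val x * corner_val y) * f == corner_val x * corner_val y.
Proof. by rewrite mulrA corner_mull -mulrA corner_mulr. Qed.

Definition corner_mul (x y : corner hf) : corner hf := Corner (corner_mul_subproof x y).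

Lemma corner_mulA : associative corner_mul.
Proof. by move=> x y z; apply: val_inj; rewrite /= mulrA. Qed.

Lemma corner_mul1r : left_id corner_one corner_mul.
Proof. by move=> x; apply: val_inj; rewrite /= corner_mull. Qed.

Lemma corner_mulr1 : right_id corner_one corner_mul.
Proof. by move=> x; apply: val_inj; rewrite /= corner_mulr. Qed.

Lemma corner_mulDl : left_distributive corner_mul +%R.
Proof. by move=> x y z; apply: val_inj; rewrite /= mulrDl. Qed.

Lemma corner_mulDr : right_distributive corner_mul +%R.
Proof. by move=> x y z; apply: val_inj; rewrite /= mulrDr. Qed.

HB.instance Definition _ := GRing.Zmodule_isPzRing.Build (corner hf)
  corner_mulA corner_mul1r corner_mulr1 corner_mulDl corner_mulDr.

End CornerRing.

(* Main.v *)
Require Import Defs.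
From HB Require Import structures.
From mathcomp Require Import all_boot all_order all_algebra.
From mathcomp Require Import boolp classical_sets constructive_ereal.
Set Implicit Arguments.
Unset Strict Implicit.
Unset Printing Implicit Defensive.
Import Order.TTheory GRing.Theory Num.Theory.
Local Open Scope ring_scope.

(** Write Λ for the algebra, f = 1 - e, Γ = fΛf, S for the simple module at e and
    N for findim Λ.  The integer l can be taken to be 1, so that only a finite N
    has to be considered and the bound to reach is 2N - 1; N is at least 1
    because pd S is.

    Let M be a Γ-module of finite projective dimension, resolved by free modules
    Γ^(c i) with differentials given by matrices D i.  The same matrices act on
    the projective Λ-modules (Λf)^(c i); this is the resolution tensored with Λf.
    Let C i be the cokernels of this complex, B i the images of its
    differentials, and H i its homology, for i > 0.  Multiplication by f recovers
    the resolution of M, so f kills H i, and therefore H i has a finite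
    filtration with factors S ([ext_zero_filtered]).  Beyond the projective
    dimension of M the cokernel C i is projective ([corner_coker_projective]), and
    0 -> H (i+1) -> C (i+1) -> B i -> 0 and 0 -> B i -> (Λf)^(c i) -> C i -> 0
    show by descending induction that every C i has finite projective dimension,
    hence at most N.

    The heart of the proof is that H m = 0 for m >= N ([complex_projective]).
    Descending on m, one knows that Ext^u(C m, S) = 0 for all u >= 0: above m the
    complex is exact, and no nonzero map goes from Λf to S, because f kills S when
    Λ is basic ([basic_top_simple]).  If H m were nonzero it would contain S
    ([top_simple_embed]).  Suppose that Ext^v(S, S) = 0 for all v > u, which holds
    when u is pd S.  Starting from Ext^(u+m+1)(C 0, S) = 0, which holds because
    m >= N, dimension shifting through the modules H i gives
    Ext^(u+1)(B (m-1), S) = 0, then Ext^u(H m, S) = 0, then Ext^u(S, S) = 0.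
    Descending to u = 0 gives Hom(S, S) = 0, which is absurd.

    So from degree N - 1 on the complex resolves C (N-1), whose N-th syzygy
    C (2N-1) must be projective.  A splitting of it restricts to the f-parts
    ([coker_corner_projective]): the syzygy of M in degree 2N - 1 is projective.

    The chain conditions behind all this come from a strictly increasing function
    on submodules ([ranked]), first built on the ideals of the artinian base ring
    ([artinian_ranked]), then transported to Λ and Γ; that S is the only simple
    module killed by f rests on Fitting's lemma ([primitive_local]). *)

(** * Linear maps, kernels and short exact sequences *)

Section BuildLinear.
Variables (R : pzRingType) (M N : lmodType R) (f : M -> N).
Hypothesis linf : linear f.
HB.instance Definition _ := GRing.isLinear.Build R M N *:%R f linf.
Definition build_linear : {linear M -> N} := f.
End BuildLinear.

Section Linear.
Variable R : pzRingType.
Implicit Types M N P Q A B C K S : lmodType R.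

Lemma const0_linear M N : linear (fun _ : M => 0 : N).
Proof. by move=> a x y; rewrite scaler0 addr0. Qed.

Definition zero_map M N : {linear M -> N} := build_linear (@const0_linear M N).

Definition surj M N (f : M -> N) := forall y, exists x, f x = y.

Lemma submodule_eq M (N N' : submodule M) : (forall x, N x <-> N' x) -> N = N'.
Proof.
case: N N' => [s s0 sD sZ] [s' s0' sD' sZ'] /= ss'.
have ess' : s = s' by apply/funext => x; apply/propext.
subst s'; congr Submodule; exact: Prop_irrelevance.
Qed.

Lemma submodB M (N : submodule M) x y : N x -> N y -> N (x - y).
Proof. by move=> Nx Ny; apply: submodD => //; rewrite -scaleN1r; apply: submodZ. Qed.

Section KernelRange.
Variables (M N : lmodType R) (f : {linear M -> N}).

Definition ker : submodule M.
Proof.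
exists (fun x => f x = 0); first exact: linear0.
- by move=> x y fx fy; rewrite linearD fx fy addr0.
- by move=> a x fx; rewrite linearZ /= fx scaler0.
Defined.

Definition preim_submod (U : submodule N) : submodule M.
Proof.
exists (fun x => U (f x)); first by rewrite linear0; apply: submod0.
- by move=> x y Ux Uy; rewrite linearD; apply: submodD.
- by move=> a x Ux; rewrite linearZ; apply: submodZ.
Defined.

Definition image_submod (U : submodule M) : submodule N.
Proof.
exists (fun y => exists2 x, U x & y = f x).
- by exists 0; [exact: submod0 | rewrite linear0].
- move=> _ _ [x Ux ->] [y Uy ->]; exists (x + y); first exact: submodD.
  by rewrite linearD.
- move=> a _ [x Ux ->]; exists (a *: x); first exact: submodZ.
  by rewrite linearZ.
Defined.

Definition rng : submodule N.
Proof.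
exists (fun y => exists x, f x = y); first by exists 0; rewrite linear0.
- by move=> _ _ [x <-] [y <-]; exists (x + y); rewrite linearD.
- by move=> a _ [x <-]; exists (a *: x); rewrite linearZ.
Defined.

End KernelRange.

Section Inclusion.
Variables (M : lmodType R) (N : submodule M).

Lemma submod_val_linear : linear (@submod_val R M N).
Proof. by []. Qed.

Definition incl : {linear submod N -> M} := build_linear submod_val_linear.

Lemma incl_inj : injective incl.
Proof. exact: val_inj. Qed.

Lemma inclP x : N (incl x).
Proof. by case: x => x /= /asboolP. Qed.

Lemma incl_ex x : N x -> exists y, incl y = x.
Proof. by move=> /asboolP Nx; exists (Submod Nx). Qed.

Lemma quotmod_pi_linear : linear (@quotmod_pi R M N).
Proof.
move=> a x y; rewrite quotmod_piD; congr (_ + _).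
exact: (esym (quotmod_scale_pi N a x)).
Qed.

Definition quo : {linear M -> quotmod N} := build_linear quotmod_pi_linear.

Lemma quo_surj : surj quo.
Proof. by move=> y; have [x ->] := quotmod_piP y; exists x. Qed.

Lemma quo0 x : quo x = 0 <-> N x.
Proof. by rewrite -[X in _ = X](linear0 quo) quotmod_piE subr0. Qed.

End Inclusion.

Lemma lin_inj M N (f : {linear M -> N}) : (forall x, f x = 0 -> x = 0) -> injective f.
Proof.
move=> f0 x y fxy; apply/eqP; rewrite -subr_eq0; apply/eqP/f0.
by rewrite linearB fxy subrr.
Qed.

Lemma inj_eq0 M N (f : {linear M -> N}) x : injective f -> f x = 0 -> x = 0.
Proof. by move=> finj fx; apply: finj; rewrite linear0. Qed.

Lemma factor_surj A B C (p : {linear A -> B}) (g : {linear A -> C}) :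
  surj p -> (forall x, p x = 0 -> g x = 0) ->
  exists h : {linear B -> C}, forall x, h (p x) = g x.
Proof.
move=> psurj pg; pose s y := projT1 (cid (psurj y)).
have ps y : p (s y) = y by rewrite /s; case: cid.
have gE x y : p x = p y -> g x = g y.
  move=> pxy; apply/eqP; rewrite -subr_eq0 -linearB; apply/eqP/pg.
  by rewrite linearB pxy subrr.
have lin : linear (fun y => g (s y)).
  by move=> a x y; rewrite -linearP; apply: gE; rewrite linearP !ps.
by exists (build_linear lin) => x; apply: gE; rewrite ps.
Qed.

Lemma factor_inj A B C (i : {linear A -> B}) (g : {linear C -> B}) :
  injective i -> (forall x, exists y, i y = g x) ->
  exists h : {linear C -> A}, forall x, i (h x) = g x.
Proof.
move=> iinj gi; pose s x := projT1 (cid (gi x)).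
have is_ x : i (s x) = g x by rewrite /s; case: cid.
have lin : linear s by move=> a x y; apply: iinj; rewrite linearP !is_ linearP.
by exists (build_linear lin) => x; apply: is_.
Qed.

Lemma copair_linear A B C (f : {linear A -> C}) (g : {linear B -> C}) :
  linear (fun x : A * B => f x.1 + g x.2).
Proof. by move=> a x y /=; rewrite !linearP /= scalerDr addrACA. Qed.

Definition copair A B C (f : {linear A -> C}) (g : {linear B -> C}) :
  {linear (A * B)%type -> C} := build_linear (copair_linear f g).

Lemma copairE A B C (f : {linear A -> C}) (g : {linear B -> C}) x :
  copair f g x = f x.1 + g x.2.
Proof. by []. Qed.

Lemma inl_linear A B : linear (fun x : A => (x, 0 : B)).
Proof. by move=> a x y; congr pair; rewrite /= ?scaler0 ?addr0. Qed.

Lemma inr_linear A B : linear (fun x : B => (0 : A, x)).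
Proof. by move=> a x y; congr pair; rewrite /= ?scaler0 ?addr0. Qed.

Definition ses A B C (i : {linear A -> B}) (p : {linear B -> C}) :=
  [/\ injective i, surj p & forall x, p x = 0 <-> exists y, i y = x].

Lemma ses_comp0 A B C (i : {linear A -> B}) (p : {linear B -> C}) x :
  ses i p -> p (i x) = 0.
Proof. by case=> _ _ ip; apply/ip; exists x. Qed.

Lemma ses_ker B C (p : {linear B -> C}) : surj p -> ses (incl (ker p)) p.
Proof.
move=> psurj; split=> // [|x]; first exact: incl_inj.
by split=> [px|[y <-]]; [exact: (incl_ex (N := ker p)) | exact: (inclP y)].
Qed.

(** * Projective and finitely generated modules *)

Lemma projective_ext P M N (p : {linear M -> N}) (f : {linear P -> N}) :
  projective P -> surj p -> exists h : {linear P -> M}, forall x, p (h x) = f x.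
Proof. by move=> projP psurj; apply: projP. Qed.

Lemma projective_retract P Q (i : {linear Q -> P}) (r : {linear P -> Q}) :
  (forall x, r (i x) = x) -> projective P -> projective Q.
Proof.
move=> ri projP M N p f psurj.
have [h ph] := @projP _ _ p (f \o r : {linear P -> N}) psurj.
by exists (h \o i : {linear Q -> M}) => x; rewrite /= ph /= ri.
Qed.

Lemma projective_sum P Q : projective P -> projective Q -> projective (P * Q)%type.
Proof.
move=> projP projQ M N p f psurj.
have [h1 ph1] := @projP _ _ p (f \o build_linear (@inl_linear P Q) : {linear P -> N}) psurj.
have [h2 ph2] := @projQ _ _ p (f \o build_linear (@inr_linear P Q) : {linear Q -> N}) psurj.
exists (copair h1 h2) => -[x y]; rewrite copairE linearD ph1 ph2 /= -linearD.
by congr (f _); congr pair; rewrite /= ?addr0 ?add0r.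
Qed.

Lemma combination_linear n M (g : 'I_n -> M) :
  linear (fun v : 'rV[R]_n => \sum_j v 0 j *: g j).
Proof.
move=> a u v; rewrite scaler_sumr -big_split; apply: eq_bigr => j _ /=.
by rewrite !mxE scalerDl scalerA.
Qed.

Definition combination n M (g : 'I_n -> M) : {linear 'rV[R]_n -> M} :=
  build_linear (combination_linear g).

Lemma projective_free n : projective 'rV[R]_n.
Proof.
move=> M N p f psurj; pose m j := projT1 (cid (psurj (f 'e_j))).
have pm j : p (m j) = f 'e_j by rewrite /m; case: cid.
exists (combination m) => v; rewrite [in RHS](row_sum_delta v).
by rewrite /combination /build_linear !linear_sum; apply: eq_bigr => j _;
  rewrite !linearZ /= pm.
Qed.

Lemma fin_gen_surj M N (p : {linear M -> N}) : surj p -> fin_gen M -> fin_gen N.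
Proof.
move=> psurj [n [g Mg]]; exists n, (fun i => p (g i)) => y.
have [x <-] := psurj y; have [c ->] := Mg x; exists c.
by rewrite linear_sum; apply: eq_bigr => i _; rewrite linearZ.
Qed.

Lemma fin_gen_cover M : fin_gen M -> exists n (p : {linear 'rV[R]_n -> M}), surj p.
Proof.
case=> n [g Mg]; exists n, (combination g) => y; have [c ->] := Mg y.
by exists (\row_j c j); apply: eq_bigr => j _; rewrite mxE.
Qed.

Lemma fin_gen_free n : fin_gen 'rV[R]_n.
Proof.
by exists n, (fun j => 'e_j) => v; exists (v 0); exact: row_sum_delta.
Qed.

Lemma fin_gen_sum M N : fin_gen M -> fin_gen N -> fin_gen (M * N)%type.
Proof.
move=> /fin_gen_cover[m [p psurj]] /fin_gen_cover[n [q qsurj]].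
have lin : linear (fun v : 'rV[R]_(m + n) => (p (lsubmx v), q (rsubmx v))).
  by move=> a u v; congr pair; rewrite /= !linearP.
apply: (fin_gen_surj (p := build_linear lin)) (fin_gen_free _) => -[x y].
have [u <-] := psurj x; have [v <-] := qsurj y.
by exists (row_mx u v); rewrite /build_linear /= row_mxKl row_mxKr.
Qed.

Definition noeth :=
  forall M (N : submodule M), fin_gen M -> fin_gen (submod N).

Lemma fin_gen_inj K M (i : {linear K -> M}) :
  noeth -> injective i -> fin_gen M -> fin_gen K.
Proof.
move=> nR iinj fgM.
have [h ih] := @factor_inj _ _ _ i (incl (rng i)) iinj (@inclP _ (rng i)).
apply: (fin_gen_surj (p := h)) (nR _ (rng i) fgM) => x.
have [|y yE] := @incl_ex _ (rng i) (i x); first by exists x.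
by exists y; apply: iinj; rewrite ih yE.
Qed.

End Linear.

(** * Vanishing of Ext *)

Section ExtVanishing.
Variable R : pzRingType.
Implicit Types M N P Q A B C K KB L S X : lmodType R.

(** [ext_zero S t M] says that Ext^(t+1)(M, S) = 0.  Quantifying over all
    projective presentations, instead of choosing one, makes dimension shifting
    hold by definition and dispenses with chain homotopies; the pieces of the
    long exact sequences used below then come from the horseshoe lemma and from
    pullbacks. *)
Fixpoint ext_zero S (t : nat) M : Prop :=
  forall P K (i : {linear K -> P}) (p : {linear P -> M}),
    projective P -> ses i p ->
    if t is t'.+1 then ext_zero S t' K
    else forall g : {linear K -> S},
           exists h : {linear P -> S}, forall x, h (i x) = g x.

(** The new presentation of B has P as a direct summand compatibly with its
    kernel; this is what the last equation records, and it lets a map defined on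
    P + Q be restricted to P. *)
Lemma horseshoe A B C (i : {linear A -> B}) (p : {linear B -> C})
    P K (k : {linear K -> P}) (u : {linear P -> A}) :
  ses i p -> fin_gen C -> ses k u ->
  exists Q L KB (l : {linear L -> Q}) (q : {linear Q -> C})
         (j : {linear KB -> (P * Q)%type}) (r : {linear (P * Q)%type -> B})
         (a : {linear K -> KB}) (b : {linear KB -> L}),
    [/\ [/\ projective Q, fin_gen Q & ses l q], ses j r, ses a b
      & forall x, j (a x) = (k x, 0)].
Proof.
move=> ip fgC ku; have [iinj psurj ker_p] := ip.
have [kinj usurj ker_u] := ku.
have [n [q qsurj]] := fin_gen_cover fgC.
have [m pm] := projective_ext q (@projective_free R n) psurj.
pose r : {linear (P * 'rV[R]_n)%type -> B} := copair (i \o u : {linear P -> B}) m.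
have rE x v : r (x, v) = i (u x) + m v by [].
have rsurj : surj r.
  move=> b; have [v qv] := qsurj (p b).
  have [|a ia] := (ker_p (b - m v)).1; first by rewrite linearB pm qv subrr.
  have [x ux] := usurj a; exists (x, v).
  by rewrite rE ux ia subrK.
have [a aE] : exists a : {linear K -> submod (ker r)},
    forall x, incl (ker r) (a x) = (k x, 0).
  have [|a aE] := @factor_inj _ _ _ _ (incl (ker r))
    (build_linear (@inl_linear _ P 'rV[R]_n) \o k : {linear K -> _}) (@incl_inj _ _ _).
    move=> x; apply: (incl_ex (N := ker r)).
    by change (r (k x, 0) = 0); rewrite rE (ses_comp0 _ ku) !linear0 addr0.
  by exists a.
have qm y : q (incl (ker r) y).2 = 0.
  have : r (incl (ker r) y) = 0 := inclP y.
  case: (incl _ y) => x v; rewrite rE addrC => /eqP; rewrite addr_eq0 => /eqP mv.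
  by rewrite -pm mv linearN (ses_comp0 _ ip) oppr0.
have [b bE] : exists b : {linear submod (ker r) -> submod (ker q)},
    forall y, incl (ker q) (b y) = (incl (ker r) y).2.
  have [|b bE] := @factor_inj _ _ _ _ (incl (ker q))
    (snd \o incl (ker r) : {linear submod (ker r) -> 'rV[R]_n}) (@incl_inj _ _ _).
    by move=> y; apply: (incl_ex (N := ker q)); exact: qm.
  by exists b.
exists 'rV[R]_n, (submod (ker q)), (submod (ker r)), (incl (ker q)), q,
  (incl (ker r)), r, a, b.
split=> //; first split; [exact: projective_free|exact: fin_gen_free|exact: ses_ker
  |exact: ses_ker|].
split=> [x y axy|w|y].
- by apply: kinj; have := congr1 (fun z => (incl (ker r) z).1) axy; rewrite !aE.
- have := inclP w; set v := incl _ w => /= qv.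
  have [|a0 ia0] := (ker_p (m v)).1; first by rewrite pm.
  have [x ux] := usurj (- a0).
  have [|y yE] := @incl_ex _ _ (ker r) (x, v).
    by change (r (x, v) = 0); rewrite rE ux linearN ia0 addNr.
  by exists y; apply: (@incl_inj _ _ (ker q)); rewrite bE yE.
split=> [by0|[x <-]].
  have y2 : (incl (ker r) y).2 = 0 by rewrite -bE by0 linear0.
  have : r (incl (ker r) y) = 0 := inclP y.
  case yE: (incl (ker r) y) y2 => [x v] y2; rewrite rE [v]y2 linear0 addr0.
  move=> /(inj_eq0 iinj) /ker_u [z zx]; exists z.
  apply: (@incl_inj _ _ (ker r)); by rewrite aE yE zx [v]y2.
by apply: (@incl_inj _ _ (ker q)); rewrite bE aE linear0.
Qed.

Lemma pullback A B C (i : {linear A -> B}) (p : {linear B -> C})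
    P K (k : {linear K -> P}) (q : {linear P -> C}) :
  ses i p -> ses k q ->
  exists X (a : {linear A -> X}) (b : {linear X -> P})
         (c : {linear K -> X}) (d : {linear X -> B}), ses a b /\ ses c d.
Proof.
move=> ip kq; have [iinj psurj ker_p] := ip; have [kinj qsurj ker_q] := kq.
have lin : linear (fun x : B * P => p x.1 - q x.2).
  by move=> a x y /=; rewrite !linearP /= scalerDr addrACA.
pose r := build_linear lin.
have rE x v : r (x, v) = p x - q v by [].
have eqr y : p (incl (ker r) y).1 = q (incl (ker r) y).2.
  by apply/eqP; rewrite -subr_eq0; apply/eqP; exact: (inclP y).
have [a aE] : exists a : {linear A -> submod (ker r)},
    forall x, incl (ker r) (a x) = (i x, 0).
  have [|a aE] := @factor_inj _ _ _ _ (incl (ker r))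
    (build_linear (@inl_linear _ B P) \o i : {linear A -> _}) (@incl_inj _ _ _).
    move=> x; apply: (incl_ex (N := ker r)).
    by change (r (i x, 0) = 0); rewrite rE (ses_comp0 _ ip) linear0 subr0.
  by exists a.
have [c cE] : exists c : {linear K -> submod (ker r)},
    forall x, incl (ker r) (c x) = (0, k x).
  have [|c cE] := @factor_inj _ _ _ _ (incl (ker r))
    (build_linear (@inr_linear _ B P) \o k : {linear K -> _}) (@incl_inj _ _ _).
    move=> x; apply: (incl_ex (N := ker r)).
    by change (r (0, k x) = 0); rewrite rE (ses_comp0 _ kq) linear0 subr0.
  by exists c.
exists (submod (ker r)), a, (snd \o incl (ker r)), c, (fst \o incl (ker r)).
split; split.
- move=> x y axy; apply: iinj.
  by have := congr1 (fun z => (incl (ker r) z).1) axy; rewrite !aE.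
- move=> v; have [b pb] := psurj (q v).
  have [|y yE] := @incl_ex _ _ (ker r) (b, v); first by change (r (b, v) = 0); rewrite rE pb subrr.
  by exists y; exact: (congr1 snd yE).
- move=> y; split=> [y2|[x <-]]; last exact: (congr1 snd (aE x)).
  have {}y2 : (incl (ker r) y).2 = 0 := y2.
  have := eqr y; rewrite y2 linear0 => /ker_p[x xE]; exists x.
  by apply: (@incl_inj _ _ (ker r)); rewrite aE xE -y2; case: (incl _ y).
- move=> x y cxy; apply: kinj.
  by have := congr1 (fun z => (incl (ker r) z).2) cxy; rewrite !cE.
- move=> b; have [v qv] := qsurj (p b).
  have [|y yE] := @incl_ex _ _ (ker r) (b, v); first by change (r (b, v) = 0); rewrite rE qv subrr.
  by exists y; exact: (congr1 fst yE).
- move=> y; split=> [y1|[x <-]]; last exact: (congr1 fst (cE x)).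
  have {}y1 : (incl (ker r) y).1 = 0 := y1.
  have := eqr y; rewrite y1 linear0 => /esym/ker_q[x xE]; exists x.
  by apply: (@incl_inj _ _ (ker r)); rewrite cE xE -y1; case: (incl _ y).
Qed.

(** The exactness of Hom(B, S) -> Hom(A, S) -> Ext^1(C, S). *)
Lemma ext_zero_extend S A B C (i : {linear A -> B}) (p : {linear B -> C})
    (g : {linear A -> S}) :
  fin_gen C -> ses i p -> ext_zero S 0 C ->
  exists h : {linear B -> S}, forall x, h (i x) = g x.
Proof.
move=> fgC ip eC; have [iinj psurj ker_p] := ip.
have [n [q qsurj]] := fin_gen_cover fgC.
have [m pm] := projective_ext q (@projective_free R n) psurj.
have [|k ik] := @factor_inj _ _ _ _ i (m \o incl (ker q) : {linear _ -> B}) iinj.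
  by move=> x; apply/ker_p; rewrite /= pm; exact: (inclP x).
have [h0 h0E] := eC _ _ _ _ (@projective_free R n) (ses_ker qsurj)
  (g \o k : {linear _ -> S}).
have [|x rx|h hE] := @factor_surj _ _ _ _ (copair i m) (copair g h0).
- move=> b; have [v qv] := qsurj (p b).
  have [|a ia] := (ker_p (b - m v)).1; first by rewrite linearB pm qv subrr.
  by exists (a, v); rewrite copairE ia subrK.
- case: x rx => a v; rewrite !copairE /= => /eqP; rewrite addr_eq0 => /eqP iamv.
  have [|w wv] := @incl_ex _ _ (ker q) v.
    by rewrite /= -pm -[m v]opprK -iamv linearN (ses_comp0 _ ip) oppr0.
  have -> : a = - k w by apply: iinj; rewrite iamv linearN ik -wv.
  by rewrite -wv h0E linearN addNr.
- exists h => x; have := hE (x, 0).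
  by rewrite !copairE /= !linear0 !addr0.
Qed.

Lemma ses_projective_split K P M (i : {linear K -> P}) (p : {linear P -> M}) :
  ses i p -> projective M -> exists r : {linear P -> K}, forall x, r (i x) = x.
Proof.
move=> ip projM; have [iinj psurj ker_p] := ip.
have [s ps] := projM _ _ p (idfun : {linear M -> M}) psurj.
have lin : linear (fun x => x - s (p x)).
  by move=> a x y; rewrite !linearP /= scalerDr addrACA.
have [|r ir] := @factor_inj _ _ _ _ i (build_linear lin) iinj.
  move=> x; apply/ker_p; change (p (x - s (p x)) = 0).
  by rewrite linearB ps subrr.
exists r => x; apply: iinj.
rewrite ir; change (i x - s (p (i x)) = i x).
by rewrite (ses_comp0 _ ip) linear0 subr0.
Qed.

Lemma ext_zero_projective S t P : projective P -> ext_zero S t P.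
Proof.
elim: t P => [|t IH] M projM P K i p projP ip;
  have [r ri] := ses_projective_split ip projM.
- by move=> g; exists (g \o r : {linear P -> S}) => x; rewrite /= ri.
- by apply: IH; apply: projective_retract ri projP.
Qed.

Lemma ext_zero_iso S t M N (f : {linear M -> N}) :
  bijective f -> ext_zero S t M -> ext_zero S t N.
Proof.
move=> [f' fK f'K] eM; have finj : injective f := can_inj fK.
have [|h hE] := @factor_inj _ _ _ _ f (idfun : {linear N -> N}) finj.
  by move=> x; exists (f' x).
have key P K (i : {linear K -> P}) (p : {linear P -> N}) :
    ses i p -> ses i (h \o p : {linear P -> M}).
  case=> iinj psurj ker_p; split=> // [x|x].
    have [y py] := psurj (f x); exists y; apply: finj.
    by rewrite hE /= py.
  rewrite -ker_p; split=> [/= /(congr1 f)|/= ->]; last by rewrite linear0.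
  by rewrite hE linear0.
by case: t eM => [|t] eM P K i p projP /key; apply: eM.
Qed.

(** The exactness of Ext^(t+1)(B) -> Ext^(t+1)(A) -> Ext^(t+2)(C). *)
Lemma ext_zero_sub S t A B C (i : {linear A -> B}) (p : {linear B -> C}) :
  noeth R -> ses i p -> fin_gen C ->
  ext_zero S t B -> ext_zero S t.+1 C -> ext_zero S t A.
Proof.
move=> nR; elim: t A B C i p => [|t IH] A B C i p ip fgC eB eC P K k u projP ku;
  have [Q [L [KB [l [q [j [r [a [b [[projQ fgQ lq] jr ab jaE]]]]]]]]]] :=
    horseshoe ip fgC ku;
  have fgL : fin_gen L by apply: (fin_gen_inj (i := l)) => //; case: lq.
- move=> g; have [g1 g1E] := ext_zero_extend g fgL ab (eC _ _ _ _ projQ lq).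
  have [h hE] := eB _ _ _ _ (projective_sum projP projQ) jr g1.
  exists (h \o build_linear (@inl_linear _ P Q) : {linear P -> S}) => x.
  by change (h (k x, 0) = g x); rewrite -jaE hE g1E.
- apply: IH ab fgL _ _; first exact: (eB _ _ _ _ (projective_sum projP projQ) jr).
  exact: (eC _ _ _ _ projQ lq).
Qed.

(** The exactness of Ext^(t+1)(C) -> Ext^(t+1)(B) -> Ext^(t+1)(A).  The syzygy of
    B embeds in the syzygy L of C with quotient A. *)
Lemma ext_zero_mid S t A B C (i : {linear A -> B}) (p : {linear B -> C}) :
  noeth R -> ses i p -> fin_gen A ->
  ext_zero S t A -> ext_zero S t C -> ext_zero S t B.
Proof.
move=> nR ip fgA eA eC; have [iinj psurj ker_p] := ip.
suff key P K (k : {linear K -> P}) (u : {linear P -> B}) : ses k u ->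
  exists L (l : {linear L -> P}) (q : {linear P -> C})
    (a : {linear K -> L}) (b : {linear L -> A}),
    [/\ ses l q, ses a b & forall x, l (a x) = k x].
  case: t eA eC => [|t] eA eC P K k u projP /key[L [l [q [a [b [lq ab la]]]]]].
    move=> g; have [g1 g1E] := ext_zero_extend g fgA ab eA.
    have [h hE] := eC _ _ _ _ projP lq g1.
    by exists h => x; rewrite -la hE g1E.
  exact: (ext_zero_sub nR ab fgA (eC _ _ _ _ projP lq) eA).
move=> ku; have [kinj usurj ker_u] := ku.
pose q : {linear P -> C} := p \o u; pose l := incl (ker q).
have qsurj : surj q.
  by move=> c; have [b <-] := psurj c; have [x <-] := usurj b; exists x.
have [|a aE] := @factor_inj _ _ _ _ l k (@incl_inj _ _ _).
  move=> x; apply: (incl_ex (N := ker q)).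
  by rewrite /= (ses_comp0 _ ku) linear0.
have [|b bE] := @factor_inj _ _ _ _ i (u \o l : {linear _ -> B}) iinj.
  by move=> x; apply/ker_p; exact: (inclP x).
exists (submod (ker q)), l, q, a, b; split=> //; first exact: ses_ker.
split=> [x y axy|z|x].
- by apply: kinj; rewrite -!aE axy.
- have [x ux] := usurj (i z).
  have [|y yE] := @incl_ex _ _ (ker q) x; first by rewrite /= ux (ses_comp0 _ ip).
  by exists y; apply: iinj; rewrite bE -ux -yE.
split=> [bx|[y <-]].
  have /ker_u[y yE] : u (l x) = 0 by have := bE x; rewrite bx linear0.
  by exists y; apply: (@incl_inj _ _ (ker q)); rewrite -/l aE.
apply: iinj; rewrite bE linear0; change (u (l (a y)) = 0).
by rewrite aE (ses_comp0 _ ku).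
Qed.

(** The exactness of Ext^(t+1)(A) -> Ext^(t+2)(C) -> Ext^(t+2)(B).  A pullback
    compares the given sequence with an arbitrary presentation of C. *)
Lemma ext_zero_quo S t A B C (i : {linear A -> B}) (p : {linear B -> C}) :
  noeth R -> ses i p -> fin_gen A -> fin_gen B ->
  ext_zero S t A -> ext_zero S t.+1 B -> ext_zero S t.+1 C.
Proof.
move=> nR ip fgA fgB eA eB P K k q projP kq.
have [X [a [b [c [d [ab cd]]]]]] := pullback ip kq.
apply: (ext_zero_sub nR cd fgB _ eB).
by apply: (ext_zero_mid nR ab fgA eA); apply: ext_zero_projective.
Qed.

(** The identity of a first syzygy extends to the free cover, which splits it. *)
Lemma ext_zero_all_projective M :
  fin_gen M -> (forall S, ext_zero S 0 M) -> projective M.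
Proof.
move=> fgM eM; have [n [p psurj]] := fin_gen_cover fgM.
have [h hE] := eM (submod (ker p)) _ _ _ _ (@projective_free R n) (ses_ker psurj)
  (idfun : {linear _ -> _}).
have lin : linear (fun v => v - incl (ker p) (h v)).
  by move=> a x y; rewrite !linearP /= scalerDr addrACA.
have [v pv|s sE] := @factor_surj _ _ _ _ p (build_linear lin) psurj.
  have [w <-] := @incl_ex _ _ (ker p) v pv.
  change (incl (ker p) w - incl (ker p) (h (incl (ker p) w)) = 0).
  by rewrite hE subrr.
apply: (projective_retract (i := s) (r := p)) (@projective_free R n) => y.
have [v <-] := psurj y; rewrite sE.
change (p (v - incl (ker p) (h v)) = p v).
by rewrite linearB [p (incl _ _)](inclP (h v)) subr0.
Qed.

End ExtVanishing.

(** * Projective dimension through vanishing of Ext *)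

Section ProjectiveDimension.
Variable R : pzRingType.
Implicit Types M N P Q K S : lmodType R.

Lemma inj_surj_bij M N (f : {linear M -> N}) : injective f -> surj f -> bijective f.
Proof.
move=> finj fsurj.
have [|h hE] := @factor_inj _ _ _ _ f (idfun : {linear N -> N}) finj.
  by move=> x; exact: fsurj.
by exists h => x; [apply: finj; rewrite hE | exact: hE].
Qed.

Lemma resolution_projective M : fin_gen M -> projective M -> proj_resolution M 0.
Proof.
move=> fgM projM.
pose Q i : lmodType R := if i is _.+1 then 'rV[R]_0 else M.
exists Q, (fun i => zero_map (Q i.+1) (Q i)), (idfun : {linear M -> M}).
split=> [[|i]|y| |i|[|i] // _ x].
- by split.
- by split; [exact: fin_gen_free | exact: projective_free].
- by exists y.
- by apply/seteqP; split=> [x /= ->|_ [_ _ <-] //]; exists 0.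
- apply/seteqP; split=> [x _|_ [_ _ <-]] //; exists 0 => //.
  by rewrite [x]thinmx0.
- exact: thinmx0.
Qed.

Lemma resolution_ses M P K n (i : {linear K -> P}) (p : {linear P -> M}) :
  ses i p -> fin_gen P -> projective P -> proj_resolution K n ->
  proj_resolution M n.+1.
Proof.
case=> iinj psurj ker_p fgP projP [Q [d [eps [Qok eps_surj ker_eps ker_d Q0]]]].
pose Q' j : lmodType R := if j is j'.+1 then Q j' else P.
pose d' j : {linear Q' j.+1 -> Q' j} :=
  if j is j'.+1 then d j' else i \o eps : {linear Q 0 -> P}.
exists Q', d', p; split=> // [[|j]| |[|j]|[|j]] //.
- exact: Qok.
- apply/seteqP; split=> [x /ker_p[y <-]|_ [x _ <-]].
    by have [z <-] := eps_surj y; exists z.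
  by apply/ker_p; exists (eps x).
- rewrite /= -ker_eps; apply/seteqP; split=> x /=; last by move=> ->; rewrite linear0.
  exact: inj_eq0.
- exact: ker_d.
- exact: Q0.
Qed.

(** Each further step of a resolution is a dimension shift; together with
    [ext_zero_resolution] this replaces finite resolutions, which are awkward to
    transport along exact sequences, by the vanishing of Ext^(n+1)(M, -). *)
Lemma resolution_ext_zero M n S t :
  noeth R -> proj_resolution M n -> (n <= t)%N -> ext_zero S t M.
Proof.
move=> nR; elim: n M t => [|n IH] M t [P [d [eps [Pok eps_surj ker_eps ker_d P0]]]] nt.
  apply: (@ext_zero_iso _ _ _ _ _ eps); last by apply: ext_zero_projective; case: (Pok 0%N).
  apply: inj_surj_bij => //; apply: lin_inj => x ex.
  have : (eps @^-1` [set 0])%classic x by [].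
  by rewrite ker_eps => -[y _ <-]; rewrite (P0 1%N isT y) linear0.
case: t nt => // t nt; have [fgP projP] := Pok 0%N.
have K := ses_ker eps_surj.
apply: (ext_zero_quo nR K (nR _ _ fgP) fgP); last exact: ext_zero_projective.
apply: IH nt.
have [|e eE] := @factor_inj _ _ _ _ (incl (ker eps)) (d 0%N) (@incl_inj _ _ _).
  move=> x; apply: (incl_ex (N := ker eps)).
  have : range (d 0%N) (d 0%N x) by exists x.
  by rewrite -ker_eps.
exists (fun i => P i.+1), (fun i => d i.+1), e; split=> [i|y| |i|i ni].
- exact: Pok.
- have : (eps @^-1` [set 0])%classic (incl (ker eps) y) by exact: (inclP y).
  rewrite ker_eps => -[x _ xE]; exists x.
  by apply: (@incl_inj _ _ (ker eps)); rewrite eE.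
- rewrite -ker_d; apply/seteqP; split=> x /=; first by move=> ex; rewrite -eE ex linear0.
  by move=> dx; apply: (@incl_inj _ _ (ker eps)); rewrite eE dx linear0.
- exact: ker_d.
- exact: P0.
Qed.

Lemma ext_zero_resolution M n :
  noeth R -> fin_gen M -> (forall S, ext_zero S n M) -> proj_resolution M n.
Proof.
move=> nR; elim: n M => [|n IH] M fgM eM.
  by apply: resolution_projective => //; apply: ext_zero_all_projective.
have [k [p psurj]] := fin_gen_cover fgM.
have fgF := @fin_gen_free R k; have projF := @projective_free R k.
apply: (resolution_ses (ses_ker psurj)) => //; apply: IH; first exact: nR.
by move=> S; apply: (eM S _ _ _ _ projF (ses_ker psurj)).
Qed.

Local Open Scope classical_set_scope.

Lemma lee_nat (m n : nat) : (m%:Z%:E <= n%:Z%:E)%E = (m <= n)%N.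
Proof. by rewrite lee_fin lez_nat. Qed.

Lemma pd_le M n : proj_resolution M n -> (pd M <= n%:Z%:E)%E.
Proof.
move=> Mn; have Mn' : [set (n%:Z)%:E | n in [set n | proj_resolution M n]] (n%:Z%:E).
  by exists n.
apply: le_infimum_Nmem => //.
have exM : exists n, `[< proj_resolution M n >] by exists n; apply/asboolP.
exists ((ex_minn exM)%:Z%:E); case: ex_minnP => m /asboolP Mm min_m; split.
  by move=> _ [j /= Mj <-]; rewrite lee_nat; apply: min_m; apply/asboolP.
by move=> x; apply; exists m.
Qed.

Lemma pd_fin M : (pd M < +oo)%E ->
  exists n, pd M = n%:Z%:E /\ proj_resolution M n.
Proof.
rewrite /pd /infimum; case: ifPn => [_|/set0P[_ [n Mn _]]]; first by rewrite ltxx.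
move=> _.
have exM : exists n, `[< proj_resolution M n >] by exists n; apply/asboolP.
case: (ex_minnP exM) => m /asboolP Mm min_m; exists m; split=> //.
apply: xget_subset1 => //; last exact: is_subset1_infimums.
split=> [_ [j /= Mj <-]|x]; last by apply; exists m.
by rewrite lee_nat; apply: min_m; apply/asboolP.
Qed.

Lemma findim_le (N : nat) :
  (forall M, fin_gen M -> (pd M < +oo)%E -> (pd M <= N%:Z%:E)%E) ->
  (findim R <= N%:Z%:E)%E.
Proof.
move=> leN; rewrite /findim /supremum; case: ifPn => [_|_]; first exact: leNye.
case: xgetP => [y _ [_ ylub]|_]; last exact: leNye.
by apply: ylub => _ [M [fgM fM ->]]; apply: leN.
Qed.

Lemma zero_module_pd : (pd ('rV[R]_0 : lmodType R) <= 0%:Z%:E)%E.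
Proof.
by apply/pd_le/resolution_projective; [exact: fin_gen_free|exact: projective_free].
Qed.

(** Finite projective dimensions are natural numbers, so a bounded family of them
    attains its supremum. *)
Lemma findim_cases :
  findim R = +oo%E \/
  exists N : nat, findim R = N%:Z%:E /\
    forall M, fin_gen M -> (pd M < +oo)%E -> (pd M <= N%:Z%:E)%E.
Proof.
pose A : set nat := [set n | exists M, [/\ fin_gen M, (pd M < +oo)%E & pd M = n%:Z%:E]].
have [zn [zE _]] := pd_fin (le_lt_trans zero_module_pd (ltry _)).
have A0 : A zn by exists 'rV[R]_0; rewrite zE ltry; split=> //; exact: fin_gen_free.
pose B : set (\bar int) := [set v | exists M, [/\ fin_gen M, (pd M < +oo)%E & v = pd M]].
have BA v : B v <-> exists2 n, A n & v = n%:Z%:E.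
  split=> [[M [fgM fM ->]]|[n [M [fgM fM Mn]] ->]]; last by exists M.
  by have [n [nE _]] := pd_fin fM; exists n => //; exists M.
have fE s : supremums B s -> findim R = s.
  move=> Bs; rewrite /findim -/B /supremum ifF; last first.
    by apply/negbTE/set0P; exists (zn%:Z%:E); apply/BA; exists zn.
  by apply: xget_subset1 => //; exact: is_subset1_supremums.
have [[b bA]|nb] := pselect (exists b, forall n, A n -> (n <= b)%N).
  right; have exA : exists n, `[< A n >] by exists zn; apply/asboolP.
  have [n /asboolP/bA //|N /asboolP AN maxN] := ex_maxnP exA (m := b).
  exists N; split.
    apply: fE; split=> [v /BA[n An ->]|v]; last by apply; apply/BA; exists N.
    by rewrite lee_nat; apply/maxN/asboolP.
  move=> M fgM fM; have [n [nE _]] := pd_fin fM.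
  by rewrite nE lee_nat; apply/maxN/asboolP; exists M.
left; apply: fE; split=> [v _|v vub]; first exact: leey.
case: v vub => [z| |] vub //; exfalso.
  apply: nb; exists `|z|%N => n An.
  have : (n%:Z%:E <= z%:E)%E by apply: vub; apply/BA; exists n.
  by rewrite lee_fin; case: z {vub} => // z; rewrite lez_nat.
by have : (zn%:Z%:E <= -oo :> \bar int)%E by apply: vub; apply/BA; exists zn.
Qed.

End ProjectiveDimension.

(** * Finite length *)

Section Ranked.
Variable R : pzRingType.
Implicit Types M A B : lmodType R.

Definition subm M (N N' : submodule M) := forall x, N x -> N' x.

(** A stand-in for finite length: a function on submodules that increases along
    strict inclusions gives both chain conditions at once, and it passes from a
    ring to its finitely generated modules without any theory of composition
    series. *)
Definition ranked M := exists rho : submodule M -> nat,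
  forall N N', subm N N' -> ~ subm N' N -> (rho N < rho N')%N.

Definition full_submod M : submodule M :=
  @Submodule R M setT I (fun _ _ _ _ => I) (fun _ _ _ => I).

Definition zero_submod M : submodule M := ker (idfun : {linear M -> M}).

Definition add_submod M (N N' : submodule M) : submodule M :=
  rng (copair (incl N) (incl N')).

Definition cap_submod M (N N' : submodule M) : submodule M.
Proof.
exists (fun x => N x /\ N' x); first by split; apply: submod0.
- by move=> x y [? ?] [? ?]; split; apply: submodD.
- by move=> a x [? ?]; split; apply: submodZ.
Defined.

Definition line M (x : M) : submodule M.
Proof.
exists (fun y => exists c : R, y = c *: x); first by exists 0; rewrite scale0r.
- by move=> _ _ [c ->] [d ->]; exists (c + d); rewrite scalerDl.
- by move=> a _ [c ->]; exists (a * c); rewrite scalerA.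
Defined.

Lemma line_mem M (x : M) : line x x.
Proof. by exists 1; rewrite scale1r. Qed.

Lemma add_submodP M (N N' : submodule M) x :
  add_submod N N' x <-> exists y z, [/\ N y, N' z & x = y + z].
Proof.
split=> [[[y z] <-]|[y [z [/incl_ex[y' <-] /incl_ex[z' <-] ->]]]].
  by exists (incl N y), (incl N' z); split; [exact: inclP| exact: inclP|].
by exists (y', z').
Qed.

Lemma addl_submod M (N N' : submodule M) : subm N (add_submod N N').
Proof.
move=> x Nx; apply/add_submodP; exists x, 0; split=> //; first exact: submod0.
by rewrite addr0.
Qed.

Lemma addr_submod M (N N' : submodule M) : subm N' (add_submod N N').
Proof.
move=> x Nx; apply/add_submodP; exists 0, x; split=> //; first exact: submod0.
by rewrite add0r.
Qed.

Lemma subm_antisym M (N N' : submodule M) : subm N N' -> subm N' N -> N = N'.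
Proof. by move=> NN' N'N; apply: submodule_eq => x; split; [exact: NN'|exact: N'N]. Qed.

Lemma rank_le M (rho : submodule M -> nat) N N' :
  (~ subm N' N -> (rho N < rho N')%N) -> subm N N' -> (rho N <= rho N')%N.
Proof.
move=> lt_rho NN'; have [N'N|/lt_rho/ltnW//] := pselect (subm N' N).
by rewrite (subm_antisym NN' N'N).
Qed.

Lemma ranked_max M (Q : submodule M -> Prop) :
  ranked M -> (exists N, Q N) ->
  exists N, Q N /\ forall N', Q N' -> subm N N' -> subm N' N.
Proof.
case=> rho lt_rho [N0 QN0].
have exN : exists n, `[< exists2 N, Q N & rho N = n >].
  by exists (rho N0); apply/asboolP; exists N0.
have bnd n : `[< exists2 N, Q N & rho N = n >] -> (n <= rho (full_submod M))%N.
  by move=> /asboolP[N _ <-]; apply: rank_le => // ; exact: lt_rho.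
have [n /asboolP[N QN rhoN] n_max] := ex_maxnP exN bnd; exists N; split=> // N' QN' NN'.
apply: contrapT => /(lt_rho _ _ NN'); rewrite rhoN ltnNge => /negP; apply.
by apply/n_max/asboolP; exists N'.
Qed.

Lemma ranked_min M (Q : submodule M -> Prop) :
  ranked M -> (exists N, Q N) ->
  exists N, Q N /\ forall N', Q N' -> subm N' N -> subm N N'.
Proof.
case=> rho lt_rho [N0 QN0].
have exN : exists n, `[< exists2 N, Q N & rho N = n >].
  by exists (rho N0); apply/asboolP; exists N0.
case: (ex_minnP exN) => n /asboolP[N QN rhoN] n_min; exists N; split=> // N' QN' N'N.
apply: contrapT => /(lt_rho _ _ N'N); rewrite rhoN ltnNge => /negP; apply.
by apply/n_min/asboolP; exists N'.
Qed.

(** The analogue, for the order of the generators, of the leading coefficient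
    ideals in the proof of Hilbert's basis theorem. *)
Definition lead_ideal M n (g : 'I_n -> M) (N : submodule M) (j : 'I_n) :
  submodule R^o.
Proof.
exists (fun c : R^o => exists d : 'I_n -> R,
  [/\ forall i : 'I_n, (j < i)%N -> d i = 0, d j = c & N (\sum_i d i *: g i)]).
- exists (fun=> 0); split=> //; rewrite big1 => [|i _]; first exact: submod0.
  by rewrite scale0r.
- move=> _ _ [c [c0 <- Nc]] [d [d0 <- Nd]]; exists (fun i => c i + d i); split=> //.
    by move=> i ji; rewrite c0 // d0 // addr0.
  have := submodD Nc Nd; rewrite -big_split.
  by congr (N _); apply: eq_bigr => i _; rewrite scalerDl.
- move=> a _ [d [d0 <- Nd]]; exists (fun i => a * d i); split=> //.
    by move=> i ji; rewrite d0 // mulr0.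
  have := submodZ a Nd; rewrite scaler_sumr.
  by congr (N _); apply: eq_bigr => i _; rewrite scalerA.
Defined.

(** Two nested submodules with the same leading coefficient ideals are equal, by
    elimination of one generator at a time. *)
Lemma ranked_fin_gen M : ranked R^o -> fin_gen M -> ranked M.
Proof.
move=> [rho lt_rho] [n [g Mg]].
exists (fun N => \sum_(j < n) rho (lead_ideal g N j))%N => N N' NN' nN'N.
have leI j : subm (lead_ideal g N j) (lead_ideal g N' j).
  by move=> c [d [d0 dj /NN' N'd]]; exists d.
have lej j : (rho (lead_ideal g N j) <= rho (lead_ideal g N' j))%N.
  by apply: rank_le => //; apply: lt_rho.
have [j nj] : exists j, ~ subm (lead_ideal g N' j) (lead_ideal g N j).
  apply: contrapT => /forallNP nex.
  have geI j : subm (lead_ideal g N' j) (lead_ideal g N j) by apply: contrapT.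
  apply: nN'N.
  suff elim_gen m d : (forall i : 'I_n, (m <= i)%N -> d i = 0) ->
      N' (\sum_i d i *: g i) -> N (\sum_i d i *: g i).
    move=> x; have [d ->] := Mg x; apply: (elim_gen n) => i.
    by rewrite leqNgt ltn_ord.
  elim: m d => [|m IH] d d0 N'd.
    rewrite big1 => [|i _]; first exact: submod0.
    by rewrite d0 // scale0r.
  have [nm|mn] := leqP n m.
    by apply: IH => // i mi; have := ltn_ord i; rewrite ltnNge (leq_trans nm mi).
  pose j := Ordinal mn.
  have [|c [c0 cj Nc]] := geI j (d j); first by exists d.
  rewrite -[\sum_i _](subrK (\sum_i c i *: g i)); apply: submodD => //.
  rewrite -sumrB (eq_bigr (fun i => (d i - c i) *: g i)) => [|i _]; last by rewrite scalerBl.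
  apply: IH => [i|].
    rewrite leq_eqVlt => /orP[/eqP mi|mi].
      have -> : i = j by apply: val_inj; rewrite /= -mi.
      by rewrite cj subrr.
    by rewrite d0 // c0 // subrr.
  rewrite (eq_bigr (fun i => d i *: g i - c i *: g i)) => [|i _]; last by rewrite scalerBl.
  by rewrite sumrB; apply: submodB => //; apply: NN'.
rewrite (bigD1 j) //= [ltnRHS](bigD1 j) //= -addSn leq_add //; first exact: lt_rho.
by apply: leq_sum.
Qed.

Lemma fin_gen_rng A B (f : {linear A -> B}) : fin_gen A -> fin_gen (submod (rng f)).
Proof.
have [h hE] := @factor_inj _ _ _ _ (incl (rng f)) f (@incl_inj _ _ _)
  (fun x => @incl_ex _ _ (rng f) (f x) (ex_intro _ x erefl)).
apply: (fin_gen_surj (p := h)) => y; have [x xy] := inclP y; exists x.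
by apply: (@incl_inj _ _ (rng f)); rewrite hE.
Qed.

Lemma ranked_noeth : ranked R^o -> noeth R.
Proof.
move=> rR M N fgM; have rM := ranked_fin_gen rR fgM.
pose Q (U : submodule M) := subm U N /\ fin_gen (submod U).
have [|U [[UN fgU] Umax]] := @ranked_max M Q rM.
  exists (rng (combination (fun _ : 'I_0 => 0 : M))); split.
    move=> x [v <-]; rewrite [v]thinmx0 linear0; exact: submod0.
  exact: fin_gen_rng (@fin_gen_free R 0).
suff NU : subm N U by rewrite (subm_antisym NU UN).
move=> x Nx; pose f := copair (incl U) (combination (fun _ : 'I_1 => x)).
have fE y v : f (y, v) = incl U y + \sum_(j < 1) v 0 j *: x by [].
apply: (Umax (rng f)).
- split; last by apply/fin_gen_rng/fin_gen_sum => //; exact: fin_gen_free.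
  move=> y [[z v] <-]; rewrite fE; apply: submodD; first exact/UN/inclP.
  by rewrite big_ord1; apply: submodZ.
- by move=> y /incl_ex[z <-]; exists (z, 0); rewrite fE big_ord1 mxE scale0r addr0.
- exists (0, const_mx 1); rewrite fE big_ord1 mxE scale1r.
  by rewrite linear0 add0r.
Qed.

(** Zorn's lemma in the form that yields maximal ideals, when x = 1 in the regular
    module, and simple quotients. *)
Lemma maximal_avoiding M (W0 : submodule M) x : ~ W0 x ->
  exists W : submodule M, [/\ subm W0 W, ~ W x &
    forall U : submodule M, subm W U -> ~ U x -> subm U W].
Proof.
move=> W0x.
(* The union of the empty chain is not a submodule, so the empty set has to
   satisfy P as well. *)
pose P (A : set M) := forall a, A a ->
  exists U : submodule M, [/\ subm W0 U, ~ U x & forall y, U y <-> A y].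
have [F FP Ftot|A [PA Amax]] := @Zorn_bigcup M P.
  move=> a [X FX Xa].
  have FU Y b : F Y -> Y b -> exists U : submodule M,
      [/\ subm W0 U, ~ U x & forall y, U y <-> Y y] by move=> /FP; apply.
  pose A : set M := (\bigcup_(X in F) X)%classic.
  have AD y z : A y -> A z -> A (y + z).
    move=> [Y FY Yy] [Z FZ Zz].
    wlog YZ : y z Y Z FY FZ Yy Zz / (Y `<=` Z)%classic.
      have [YZ|ZY] := Ftot _ _ FY FZ; first by move=> /(_ y z Y Z FY FZ Yy Zz YZ).
      by move=> /(_ z y Z Y FZ FY Zz Yy ZY); rewrite addrC.
    have [U [_ _ UZ]] := FU _ _ FZ Zz; exists Z => //.
    by apply/UZ; apply: submodD; apply/UZ => //; apply: YZ.
  have AZ c y : A y -> A (c *: y).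
    move=> [Y FY Yy]; have [U [_ _ UY]] := FU _ _ FY Yy; exists Y => //.
    by apply/UY; apply: submodZ; apply/UY.
  have [U [W0U _ UX]] := FU _ _ FX Xa.
  have A0 : A 0 by exists X => //; apply/UX; exact: submod0.
  exists (@Submodule R M A A0 AD AZ); split=> //.
    by move=> y /W0U /UX Xy; exists X.
  move=> [Y FY Yx]; have [V [_ Vx VY]] := FU _ _ FY Yx.
  by apply: Vx; apply/VY.
have [[a Aa]|A0] := pselect (exists a, A a).
  have [W [W0W Wx WA]] := PA a Aa; exists W; split=> // U WU Ux y Uy.
  apply: contrapT => Wy; apply: (Amax U).
    by split=> [z /WA /WU //|UA]; apply/Wy/WA/UA.
  by move=> b Ub; exists U; split=> // z /W0W /WU.
exfalso; apply: (Amax W0) => [|b Wb]; last by exists W0; split.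
split=> [b Ab|WA]; first by exfalso; apply: A0; exists b.
by apply: A0; exists 0; apply: WA; exact: submod0.
Qed.

Lemma artinian_min (Q : submodule R^o -> Prop) :
  artinian R -> (exists I, Q I) ->
  exists I, Q I /\ forall J, Q J -> subm J I -> subm I J.
Proof.
move=> artR [I0 QI0]; apply: contrapT => /forallNP nomin.
have next (I : {I | Q I}) : {J : {J | Q J} | subm (sval J) (sval I) /\
    ~ subm (sval I) (sval J)}.
  apply: cid; case: I => I QI /=.
  have /not_andP[//|/existsNP[J /not_implyP[QJ /not_implyP[JI nIJ]]]] := nomin I.
  by exists (exist _ J QJ).
pose fix chain n := if n is n'.+1 then sval (next (chain n')) else exist _ I0 QI0.
have [n x|m mP] := artR (fun n => sval (chain n)).
  by rewrite /=; case: (next _) => J /= [JI _]; apply: JI.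
have := mP m.+1 (leqnSn m) => {mP} /=; case: (next _) => J /= [_ nIJ] eqIJ.
by apply: nIJ => x Ix; apply/eqIJ.
Qed.

End Ranked.

(** * Artinian commutative rings *)

Section CommutativeArtinian.
Variable k : comNzRingType.
Hypothesis artk : artinian k.
Implicit Types I J K U W : submodule k^o.

Definition ranked_above I := exists rho : submodule k^o -> nat,
  forall N N', subm I N -> subm N N' -> ~ subm N' N -> (rho N < rho N')%N.

(** As I/W is simple, a chain of ideals above W can stay constant modulo I only
    once, when it starts to contain I. *)
Lemma ranked_above_simple I W :
  subm W I -> (forall U, subm W U -> subm U I -> ~ subm U W -> subm I U) ->
  ranked_above I -> ranked_above W.
Proof.
move=> WI simple [rho lt_rho].
exists (fun N => (rho (add_submod N I) + `[< subm I N >])%N) => N N' WN NN' nN'N.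
have NIN' : subm (add_submod N I) (add_submod N' I).
  move=> x /add_submodP[y [z [/NN' N'y Iz ->]]].
  by apply/add_submodP; exists y, z.
have le_rho : (rho (add_submod N I) <= rho (add_submod N' I))%N.
  by apply: (rank_le _ NIN') => ?; apply: lt_rho => //; exact: addr_submod.
have lt_rho' : ~ subm (add_submod N' I) (add_submod N I) ->
    (rho (add_submod N I) < rho (add_submod N' I))%N.
  by move=> ?; apply: lt_rho => //; exact: addr_submod.
case: asboolP => [IN|nIN].
  have -> : `[< subm I N' >] = true by apply/asboolP => x /IN /NN'.
  rewrite ltn_add2r; apply: lt_rho' => N'N; apply: nN'N => x /(@addl_submod _ _ N' I)/N'N.
  by move=> /add_submodP[y [z [Ny /IN Nz ->]]]; apply: submodD.
case: asboolP => [IN'|nIN']; first by rewrite addn0 addn1 ltnS.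
rewrite !addn0; apply: lt_rho' => N'N; apply: nN'N => x N'x.
have /N'N/add_submodP[y [z [Ny Iz xE]]] := addl_submod I N'x.
rewrite xE; apply: submodD => //; apply: (WN z).
have capW : subm (cap_submod N' I) W.
  apply: contrapT => ncap; apply: nIN' => w Iw.
  have /(_ w Iw)[] // : subm I (cap_submod N' I).
  apply: simple => // [u Wu|u []//].
  by split; [apply/NN'/WN|apply: WI].
apply: capW; split=> //; rewrite -[z](addKr y) -xE addrC.
by apply: submodB => //; apply: NN'.
Qed.

(** Let I be a minimal ideal with k/I of finite length.  It has no simple
    quotient, so I = mI for each maximal ideal m.  If I were nonzero, choose K
    minimal among the ideals with KI nonzero, x in K with xI nonzero, and m
    containing the annihilator of x.  Then (xm)I = xI is nonzero, so K = xm by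
    minimality and x = xa with a in m; hence 1 - a annihilates x and 1 lies in
    m. *)
Lemma artinian_ranked : ranked k^o.
Proof.
have [|I [rI Imin]] := @artinian_min _ ranked_above artk.
  by exists (full_submod _), (fun=> 0%N) => N N' fN _ []; move=> x _; apply: fN.
suff I0 : forall z, I z -> z = 0.
  case: rI => rho lt_rho; exists rho => N N'; apply: lt_rho => x /I0 ->.
  exact: submod0.
pose maxl (m : submodule k^o) := ~ m 1 /\
  forall U : submodule k^o, subm m U -> ~ U 1 -> subm U m.
pose mul_in (m W : submodule k^o) := forall a y : k^o, m a -> I y -> W (a * y).
have maxl_inv m c : maxl m -> ~ m c -> exists a b : k^o, m a /\ 1 = a + b * c.
  move=> [m1 mmax] mc.
  have /add_submodP[a [_ [ma [b ->] E]]] : add_submod m (line (c : k^o)) 1.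
    apply: contrapT => n1; apply: mc; apply: mmax n1 _ _; first exact: addl_submod.
    exact/addr_submod/line_mem.
  by exists a, b.
have sub_mI (m W0 : submodule k^o) : maxl m -> mul_in m W0 -> subm I W0.
  move=> maxm mIW0 x Ix; apply: contrapT => W0x.
  have [W' [WW' W'x W'max]] := maximal_avoiding W0x.
  have mIW : mul_in m W' by move=> a y ma Iy; apply/WW'/mIW0.
  have out y : ~ W' y -> exists c : k^o, W' (x - c * y).
    move=> W'y.
    have /add_submodP[w [_ [W'w [c ->] ->]]] : add_submod W' (line y) x.
      apply: contrapT => nx; apply: W'y; apply: W'max nx _ _; first exact: addl_submod.
      exact/addr_submod/line_mem.
    by exists c; rewrite addrK.
  have WI : subm (cap_submod W' I) I by move=> y [].
  suff simple : forall U, subm (cap_submod W' I) U -> subm U I ->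
      ~ subm U (cap_submod W' I) -> subm I U.
    have rW := ranked_above_simple WI simple rI.
    by have [] := Imin _ rW WI x Ix.
  move=> U WU UI nUW.
  have [y /not_implyP[Uy Wy]] : exists y, ~ (U y -> cap_submod W' I y).
    by apply/existsNP.
  have [|c cE] := out y; first by move=> W'y; apply: Wy; split=> //; apply: UI.
  have Ux : U x.
    rewrite -[x](subrK (c * y)); apply: submodD; last exact: (submodZ c Uy).
    apply: WU; split=> //; apply: submodB => //.
    exact: (submodZ c (UI _ Uy)).
  move=> z Iz; have [W'z|W'z] := pselect (W' z); first by apply: WU.
  have [d dE] := out z W'z.
  have [|a [b [ma E]]] := @maxl_inv m d maxm.
    move=> md; apply: W'x; rewrite -[x](subrK (d * z)); apply: submodD => //.
    exact: mIW.
  have -> : z = (a * z - b * (x - d * z)) + b * x.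
    by rewrite mulrBr opprB addrA subrK mulrA -mulrDl -E mul1r.
  apply: submodD; last exact: (submodZ b Ux).
  apply: WU; split.
    by apply: submodB; [exact: mIW|exact: (submodZ b dE)].
  apply: submodB; first exact: (submodZ a Iz).
  by apply/(submodZ b)/submodB => //; exact: (submodZ d Iz).
move=> z Iz; apply: contrapT => z0.
pose nz (K : submodule k^o) := exists x y : k^o, [/\ K x, I y & x * y <> 0].
have [|K [[x [y [Kx Iy xy]]] Kmin]] := @artinian_min _ nz artk.
  by exists (full_submod _), 1, z; split=> //; rewrite mul1r.
have lin : linear (fun r : k^o => r * x : k^o).
  by move=> a u v; rewrite mulrDl -mulrA.
pose mulx := build_linear lin.
have [|m [annm m1 mmax]] := @maximal_avoiding _ _ (ker mulx) 1.
  move=> x0; apply: xy; rewrite (_ : x = 0) ?mul0r //.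
  by rewrite -[x]mul1r; exact: x0.
have maxm : maxl m by split.
have [|u /= uK|a ma xE] := Kmin (image_submod mulx m) _ _ x Kx.
- apply: contrapT => nnz; apply: xy; rewrite mulrC.
  apply: (sub_mI m (ker mulx) maxm _ y Iy) => a w ma Iw.
  apply: contrapT => awx; apply: nnz; exists (a * x), w; split=> //.
    by exists a.
  by move=> axw; apply: awx; change (a * w * x = 0); rewrite mulrAC.
- by case: uK => r mr ->; exact: (submodZ r Kx).
apply: m1; rewrite -[1](subrK a); apply: submodD => //; apply: annm.
by change ((1 - a) * x = 0); rewrite mulrBl mul1r -[a * x]xE subrr.
Qed.

End CommutativeArtinian.

(** * Artin algebras and their corner rings *)

Definition restrict_scalars (k : comNzRingType) (L : algType k)
  (N : submodule L^o) : submodule (L : lmodType k).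
Proof.
exists (fun x : L => N x); [exact: submod0 | exact: (@submodD _ _ N) |].
by move=> a x Nx; rewrite -[x]mul1r scalerAl; exact: (submodZ (a%:A) Nx).
Defined.

Lemma artin_algebra_ranked (k : comNzRingType) (L : algType k) :
  artin_algebra L -> ranked L^o.
Proof.
move=> [artk fgL].
have [rho lt_rho] := ranked_fin_gen (artinian_ranked artk) fgL.
by exists (fun N => rho (restrict_scalars N)) => N N' NN' nN'N; apply: lt_rho.
Qed.

Section CornerRanked.
Variables (R : pzRingType) (f : R) (hf : idem f).

Definition to_corner (x : R) : corner hf.
Proof. by apply: (@Corner _ _ (f * x * f)); rewrite !mulrA hf -!mulrA hf. Defined.

Lemma to_corner_val (x : corner hf) : to_corner (corner_val x) = x.
Proof. by apply: val_inj; rewrite /= corner_mull // corner_mulr. Qed.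

Lemma to_cornerD x y : to_corner (x + y) = to_corner x + to_corner y.
Proof. by apply: val_inj; rewrite /= mulrDr mulrDl. Qed.

Lemma to_cornerMl (a : R) (x : corner hf) :
  to_corner (a * corner_val x) = to_corner a * x.
Proof.
apply: val_inj; rewrite /= -!mulrA; congr (f * (a * _)).
by rewrite corner_mulr // corner_mull.
Qed.

(** The largest left ideal J of R with fJf contained in I; it remembers I, by
    [corner_extend_val]. *)
Definition corner_extend (I : submodule (corner hf)^o) : submodule R^o.
Proof.
exists (fun y : R^o => forall a : R, I (to_corner (a * y))).
- move=> a; rewrite mulr0 (_ : to_corner 0 = 0); first exact: submod0.
  by apply: val_inj; rewrite /= mulr0 mul0r.
- by move=> x y Ix Iy a; rewrite mulrDr to_cornerD; apply: submodD.
- by move=> b x Ix a; rewrite mulrA; apply: Ix.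
Defined.

Lemma corner_extend_val (I : submodule (corner hf)^o) (x : corner hf) :
  corner_extend I (corner_val x) <-> I x.
Proof.
split=> [/(_ 1)|Ix a]; first by rewrite mul1r to_corner_val.
by rewrite to_cornerMl; exact: (submodZ (to_corner a) Ix).
Qed.

Lemma corner_ranked : ranked R^o -> ranked (corner hf)^o.
Proof.
move=> [rho lt_rho]; exists (fun I => rho (corner_extend I)) => I J IJ nJI.
apply: lt_rho => [x Ix a|JI]; first exact/IJ/Ix.
by apply: nJI => x; rewrite -!corner_extend_val; exact: JI.
Qed.

End CornerRanked.

(** * The simple module at a primitive idempotent *)

Section PrimitiveIdempotent.
Variable R : pzRingType.
Hypothesis rankedR : ranked R^o.
Variable e : R.
Hypothesis prim_e : primitive_idem e.
Implicit Types M H S : lmodType R.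

Lemma right_mul_linear (x : R) : linear (fun r : R^o => r * x : R^o).
Proof. by move=> a u v; rewrite mulrDl -mulrA. Qed.

Definition right_mul (x : R) : {linear R^o -> R^o} := build_linear (right_mul_linear x).

(** The images and the kernels of right multiplication by the powers of a become
    stationary, so a high power and its square have the same ones. *)
Lemma power_stationary (a : R) : exists n, [/\ (0 < n)%N,
  exists w, a ^+ n = w * (a ^+ n * a ^+ n) &
  forall y, y * (a ^+ n * a ^+ n) = 0 -> y * a ^+ n = 0].
Proof.
have [|N1 [[n1 ->] min1]] :=
  @ranked_min _ _ (fun N => exists n, N = rng (right_mul (a ^+ n))) rankedR.
  by exists (rng (right_mul (a ^+ 0))), 0%N.
have [|N2 [[n2 ->] max2]] :=
  @ranked_max _ _ (fun N => exists n, N = ker (right_mul (a ^+ n))) rankedR.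
  by exists (ker (right_mul (a ^+ 0))), 0%N.
pose n := (n1 + n2).+1; exists n; split=> //; rewrite -exprD.
  have [|_ [r <-]| |r rE] := min1 (rng (right_mul (a ^+ (n + n)))) _ _ (a ^+ n1).
  - by exists (n + n)%N.
  - exists (r * a ^+ (n + n - n1)).
    change (r * a ^+ (n + n - n1) * a ^+ n1 = r * a ^+ (n + n)).
    rewrite -mulrA -exprD subnK //.
    by apply: (leq_trans _ (leq_addr n n)); rewrite /n leqW // leq_addr.
  - by exists 1; change (1 * a ^+ n1 = a ^+ n1); rewrite mul1r.
  have nn1 : (n = n2.+1 + n1)%N by rewrite /n addSn addnC.
  exists (a ^+ n2.+1 * r); rewrite {1}nn1 exprD -mulrA; congr (_ * _).
  exact: (esym rE).
move=> y yn.
have y2 : y * a ^+ n2 = 0.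
  apply: (max2 (ker (right_mul (a ^+ (n + n))))) => //; first by exists (n + n)%N.
  move=> z zn; change (z * a ^+ (n + n) = 0).
  have -> : (n + n = n2 + (n + n - n2))%N.
    rewrite subnKC //.
    by apply: (leq_trans _ (leq_addr n n)); rewrite /n leqW // leq_addl.
  by rewrite exprD mulrA [z * _]zn mul0r.
have -> : n = (n2 + n1.+1)%N by rewrite /n addnS addnC.
by rewrite exprD mulrA y2 mul0r.
Qed.

(** The ring eRe is local, by Fitting's lemma: for a power b of a with stationary
    image and kernel, writing b = w b b splits e into the orthogonal idempotents
    e - w b and w b. *)
Lemma primitive_local (a : R) : e * a * e = a ->
  (exists r, e = r * a) \/ (exists r, e = r * (e - a)).
Proof.
move=> eae; have [ee e0 indec] := prim_e.
have ea : e * a = a by rewrite -eae !mulrA ee.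
have ae : a * e = a by rewrite -eae -!mulrA ee.
have [[|n] [] // _ [w0 bE] ker_b] := power_stationary a.
set b := a ^+ n.+1 in bE ker_b.
have eb : e * b = b by rewrite /b exprS mulrA ea.
have be : b * e = b by rewrite /b exprSr -mulrA ae.
pose w := e * w0 * e; pose v := w * b; pose u := e - v.
have vb : v * b = b by rewrite /v /w -!mulrA (mulrA e b) eb -bE eb.
have ub : u * b = 0 by rewrite /u mulrBl eb vb subrr.
have uv : u * v = 0.
  rewrite /v mulrA; apply: ker_b.
  by rewrite mulrA -[u * w * b]mulrA -/v -mulrA vb ub.
have ev : e * v = v by rewrite /v /w !mulrA ee.
have ve : v * e = v by rewrite /v -mulrA be.
have vv : v * v = v.
  by apply/eqP; rewrite eq_sym -subr_eq0 -{1}ev -mulrBl uv.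
have vu : v * u = 0 by rewrite /u mulrBr ve vv subrr.
have uu : u * u = u by rewrite {1}/u mulrBl vu subr0 /u mulrBr ee ev.
have [u0|v0] : u = 0 \/ v = 0 by apply: indec => //; rewrite /u subrK.
  left; exists (w * a ^+ n); rewrite -mulrA -exprSr -/b -/v.
  by apply/eqP; rewrite -subr_eq0 -/u u0.
right; have b0 : b = 0 by rewrite -vb v0 mul0r.
(* The geometric sum 1 + a + a^2 + ..., as a is nilpotent. *)
have geom m : exists r, e - e * a ^+ m = r * (e - a).
  elim: m => [|m [r rE]]; first by exists 0; rewrite mulr1 subrr mul0r.
  have comm : a * (e - a) = (e - a) * a by rewrite mulrBr mulrBl ae ea.
  exists (1 + r * a); rewrite mulrDl mul1r -mulrA comm mulrA -rE mulrBl ea.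
  by rewrite -mulrA -exprSr addrA subrK.
have [r] := geom n.+1; rewrite -/b b0 mulr0 subr0 => rE.
by exists r.
Qed.

(** If x = xe avoids a maximal left ideal I, then 1 = i + c x with i in I; as eRe
    is local, one of e i and e c x generates Re, and it cannot be e i. *)
Lemma not_rad_generates (x : R) : x * e = x -> ~ rad_set x -> exists c, e = c * x.
Proof.
move=> xe /existsNP[I /not_implyP[[I1 maxI] Ix]]; have [ee _ _] := prim_e.
have [||] := maxI (add_submod I (line (x : R^o))); first exact: addl_submod.
  move=> /add_submodP[i [_ [Ii [c ->] E]]].
  have {}E : 1 = i + c * x :> R := E.
  pose a := e * (c * x).
  have eae : e * a * e = a by rewrite /a !mulrA ee -!mulrA xe.
  have eiE : e - a = e * i by rewrite /a -{1}(mulr1 e) E mulrDr addrK.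
  case: (primitive_local eae) => [[r eE]|[r eE]].
    by exists (r * e * c); rewrite {1}eE /a !mulrA.
  exfalso; apply: Ix; rewrite -xe eE eiE !mulrA.
  exact: (submodZ (x * r * e) Ii).
by move=> /(_ x) xI; exfalso; apply/Ix/xI/addr_submod/line_mem.
Qed.

(** A module killed by 1 - e has a simple submodule T generated by some x = ex.
    The annihilator of x is a maximal left ideal, so it contains the radical;
    conversely an element of Re outside the radical generates Re, so it does not
    kill x. *)
Lemma top_simple_embed H :
  fin_gen H -> (forall x : H, (1 - e) *: x = 0) -> (exists x : H, x <> 0) ->
  exists j : {linear top_simple e -> H}, injective j /\ exists y : top_simple e, y <> 0.
Proof.
move=> fgH fH [x0 x0_neq0]; have [ee e0 _] := prim_e.
have e_act (y : H) : e *: y = y.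
  by have := fH y; rewrite scalerBl scale1r => /eqP; rewrite subr_eq0 => /eqP <-.
have [|T [[x [Tx x_neq0]] Tmin]] := @ranked_min _ _
    (fun N : submodule H => exists x, N x /\ x <> 0) (ranked_fin_gen rankedR fgH).
  by exists (full_submod H), x0.
have lin_actx : linear (fun r : R^o => (r : R) *: x : H).
  by move=> a u v; rewrite scalerDl scalerA.
pose actx := build_linear lin_actx; pose ann := ker actx.
have max_ann : maximal_left_ideal ann.
  split=> [|J annJ]; first by move=> x0'; apply: x_neq0; rewrite -[x]scale1r.
  have [[y [Jxy y0]]|nJ] := pselect (exists y, image_submod actx J y /\ y <> 0).
    left; have : subm T (image_submod actx J).
      by apply: Tmin; [exists y | move=> _ [r _ ->]; exact: submodZ].
    move=> /(_ _ Tx)[j Jj jx]; rewrite -[1](subrK j); apply: submodD => //.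
    apply: annJ; change ((1 - j : R) *: x = 0).
    by rewrite scalerBl scale1r {1}jx subrr.
  right=> r Jr; apply: contrapT => rx; apply: nJ; exists (actx r); split=> //.
  by exists r.
have rad_ann (r : R) : rad_set r -> r *: x = 0 by move=> /(_ _ max_ann).
have ann_rad (a : R) : a * e = a -> a *: x = 0 -> rad_set a.
  move=> ae ax; apply: contrapT => /(not_rad_generates ae)[c eE].
  by apply: x_neq0; rewrite -(e_act x) eE -scalerA ax scaler0.
pose Re := principal e.
pose g : {linear submod Re -> H} := actx \o incl Re.
have [|h hE] := @factor_surj _ _ _ _ (quo (submod_in Re (ideal_mul (Defs.rad R) e))) g
  (@quo_surj _ _ _).
  move=> y /quo0 [r rad_r yE]; change ((incl Re y : R) *: x = 0).
  by rewrite [incl Re y]yE -scalerA e_act; apply: rad_ann.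
exists h; split; last first.
  have [|a aE] := @incl_ex _ _ Re e; first by exists e.
  exists (quo _ a) => qa0; apply: x_neq0; rewrite -(e_act x) -aE.
  by have := hE a; rewrite qa0 linear0.
apply: lin_inj => y; have [a <-] := quo_surj y.
rewrite hE => ax; apply/quo0.
have aee : (incl Re a : R) * e = incl Re a.
  by have [r _ ->] := inclP a; rewrite -mulrA ee.
by exists (incl Re a); [exact: ann_rad | exact: (esym aee)].
Qed.

Lemma fin_gen_regular : fin_gen R^o.
Proof.
by exists 1%N, (fun=> 1) => x; exists (fun=> x); rewrite big_ord1 [_ *: _]mulr1.
Qed.

Lemma fin_gen_top_simple : fin_gen (top_simple e).
Proof.
apply: (fin_gen_surj (@quo_surj _ _ _)).
exact: ranked_noeth rankedR _ _ fin_gen_regular.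
Qed.

(** A finitely generated module killed by 1 - e is filtered by copies of S_e: a
    maximal submodule U with the required vanishing is everything, because
    otherwise H / U contains a copy of S_e, which can be added to U. *)
Lemma ext_zero_filtered S t H :
  fin_gen H -> (forall x : H, (1 - e) *: x = 0) ->
  ext_zero S t (top_simple e) -> ext_zero S t H.
Proof.
move=> fgH fH eS; have nR := ranked_noeth rankedR.
have [|U [eU maxU]] := @ranked_max _ H (fun U => ext_zero S t (submod U))
    (ranked_fin_gen rankedR fgH).
  exists (zero_submod H); apply/ext_zero_projective => M N p g psurj.
  exists (zero_map _ _) => x; rewrite linear0.
  have -> : x = 0 by apply: (@incl_inj _ _ (zero_submod H)); exact: (inclP x).
  by rewrite linear0.
have [UH|nUH] := pselect (forall x, U x).
  apply: ext_zero_iso eU; apply: (inj_surj_bij (f := incl U)); first exact: incl_inj.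
  by move=> x; apply: incl_ex.
have fgQ : fin_gen (quotmod U) := fin_gen_surj (@quo_surj _ _ U) fgH.
have [||j [jinj [z z0]]] := top_simple_embed fgQ.
- by move=> y; have [x <-] := quo_surj y; rewrite -linearZ fH linear0.
- have [x Ux] : exists x, ~ U x by apply/existsNP.
  by exists (quo U x) => /quo0.
pose V := preim_submod (quo U) (rng j).
have UV : subm U V.
  by move=> x /quo0 Ux; exists 0; rewrite linear0.
exfalso.
have [a aE] : exists a : {linear submod U -> submod V},
    forall x, incl V (a x) = incl U x.
  have [|a aE] := @factor_inj _ _ _ _ (incl V) (incl U) (@incl_inj _ _ _).
    by move=> x; apply/incl_ex/UV/inclP.
  by exists a.
have [b bE] : exists b : {linear submod V -> top_simple e},
    forall x, j (b x) = quo U (incl V x).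
  have [|b bE] := @factor_inj _ _ _ _ j (quo U \o incl V : {linear _ -> _}) jinj.
    by move=> x; exact: (inclP x).
  by exists b.
have ab : ses a b.
  split=> [x y axy|y|x].
  - by apply: (@incl_inj _ _ U); rewrite -!aE axy.
  - have [x xE] := quo_surj (j y); have [|v vE] := @incl_ex _ _ V x.
      by exists y; rewrite xE.
    by exists v; apply: jinj; rewrite bE vE xE.
  - split=> [bx|[y <-]].
      have /quo0/incl_ex[y yE] : quo U (incl V x) = 0 by rewrite -bE bx linear0.
      by exists y; apply: (@incl_inj _ _ V); rewrite aE yE.
    by apply: jinj; rewrite bE linear0 aE; apply/quo0/inclP.
have VU : subm V U.
  by apply: maxU => //; exact: ext_zero_mid nR ab (nR _ _ fgH) eU eS.
apply: z0; apply: jinj; have [x xE] := quo_surj (j z).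
rewrite linear0 -xE; apply/quo0/VU; exists z.
by rewrite xE.
Qed.

End PrimitiveIdempotent.

Section PrimitiveDecomposition.
Variable R : pzRingType.
Hypothesis rankedR : ranked R^o.

(** Two primitive idempotents joined by an element outside the radical generate
    isomorphic projectives: x has a left inverse s, and x s is a nonzero
    idempotent of gRg, hence equal to g. *)
Lemma primitive_iso (e g x : R) : primitive_idem e -> primitive_idem g ->
  g * x = x -> x * e = x -> ~ rad_set x ->
  lmod_iso (submod (principal g)) (submod (principal e)).
Proof.
move=> prim_e prim_g gx xe nrad; have [ee e0 _] := prim_e; have [gg _ indec] := prim_g.
have [c cE] := not_rad_generates rankedR prim_e xe nrad.
have [s [sx es sg]] : exists s, [/\ s * x = e, e * s = s & s * g = s].
  exists (e * c * g); split; first by rewrite -!mulrA gx -cE ee.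
    by rewrite !mulrA ee.
  by rewrite -!mulrA gg.
have idem_xs : idem (x * s) by rewrite /idem -mulrA (mulrA s) sx es.
have gxs : g * (x * s) = x * s by rewrite mulrA gx.
have xsg : x * s * g = x * s by rewrite -mulrA sg.
have xsE : x * s = g.
  have [|||||E|E] := indec (x * s) (g - x * s).
  - exact: idem_xs.
  - by rewrite /idem mulrBr !mulrBl gg gxs xsg idem_xs subrr subr0.
  - by rewrite mulrBr xsg idem_xs subrr.
  - by rewrite mulrBl gxs idem_xs subrr.
  - by rewrite addrCA subrr addr0.
  - have E' : e = s * (x * s) * x by rewrite -!mulrA sx xe sx.
    by exfalso; apply: e0; rewrite E' E mulr0 mul0r.
  - by apply/esym/eqP; rewrite -subr_eq0 E.
pose Pg := principal g; pose Pe := principal e.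
have to_e y : exists z, incl Pe z = right_mul x (incl Pg y).
  apply: incl_ex; exists (incl Pg y * x : R) => //.
  by rewrite -mulrA xe.
have to_g y : exists z, incl Pg z = right_mul s (incl Pe y).
  apply: incl_ex; exists (incl Pe y * s : R) => //.
  by rewrite -mulrA sg.
have [u uE] := @factor_inj _ _ _ _ (incl Pe)
  (right_mul x \o incl Pg : {linear submod Pg -> _}) (@incl_inj _ _ _) to_e.
have [v vE] := @factor_inj _ _ _ _ (incl Pg)
  (right_mul s \o incl Pe : {linear submod Pe -> _}) (@incl_inj _ _ _) to_g.
exists u, v => y.
- apply: (@incl_inj _ _ Pg); rewrite vE; change (incl Pe (u y) * s = incl Pg y).
  rewrite uE; change (incl Pg y * x * s = incl Pg y).
  by have [r _ ->] := inclP y; rewrite -!mulrA xsE gg.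
- apply: (@incl_inj _ _ Pe); rewrite uE; change (incl Pg (v y) * x = incl Pe y).
  rewrite vE; change (incl Pe y * s * x = incl Pe y).
  by have [r _ ->] := inclP y; rewrite -!mulrA sx ee.
Qed.

Lemma orthogonal_sum n (h : 'I_n -> R) g i :
  (forall i, idem (h i)) -> (forall i j, i != j -> h i * h j = 0) ->
  \sum_i h i = g -> g * h i = h i /\ h i * g = h i.
Proof.
move=> idem_h orth <-; split.
- rewrite mulr_suml (bigD1 i) //= big1 ?addr0 => [|j]; [exact: idem_h | exact: orth].
- rewrite mulr_sumr (bigD1 i) //= big1 ?addr0 => [|j]; first exact: idem_h.
  by rewrite eq_sym; exact: orth.
Qed.

(** Splitting an idempotent shrinks the left ideal that it generates, so the
    process stops. *)
Lemma idem_decomposition g : idem g -> exists n (h : 'I_n -> R),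
  [/\ forall i, primitive_idem (h i), forall i j, i != j -> h i * h j = 0
    & \sum_i h i = g].
Proof.
case: rankedR => rho lt_rho.
have [m] := ubnP (rho (line (g : R^o))); elim: m g => // m IH g gm gg.
have [g0|g0] := pselect (g = 0).
  by exists 0%N, (fun=> 0); split=> [[]//|[]//|]; rewrite big_ord0.
have [prim_g|nprim] := pselect (primitive_idem g).
  exists 1%N, (fun=> g); split=> // [i j|]; last by rewrite big_ord1.
  by rewrite !ord1.
have [a [b [aa bb ab ba [gE a0 b0]]]] : exists a b, [/\ idem a, idem b, a * b = 0,
    b * a = 0 & [/\ g = a + b, a <> 0 & b <> 0]].
  apply: contrapT => nab; apply: nprim; split=> // a b aa bb ab ba gE.
  apply: contrapT => /not_orP[a0 b0]; apply: nab.
  by exists a, b; split.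
have smaller c d : idem c -> idem d -> c * d = 0 -> d * c = 0 -> g = c + d ->
    d <> 0 -> (rho (line (c : R^o)) < m)%N.
  move=> cc dd cd dc gcd d0; rewrite -ltnS; apply: leq_trans gm; rewrite ltnS.
  apply: lt_rho => [_ [r ->]|gc].
    exists (r * c); change (r * c = r * c * g).
    by rewrite gcd mulrDr -!mulrA cc cd mulr0 addr0.
  have [r rE] := gc _ (line_mem _); have {}rE : g = r * c := rE.
  have gd : g * d = d by rewrite gcd mulrDl cd dd add0r.
  by apply: d0; rewrite -gd rE -mulrA cd mulr0.
have [p [ha [prim_a orth_a sum_a]]] := IH a (smaller a b aa bb ab ba gE b0) aa.
have gE' : g = b + a by rewrite addrC.
have [q [hb [prim_b orth_b sum_b]]] := IH b (smaller b a bb aa ba ab gE' a0) bb.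
have hbE j := orthogonal_sum j (fun i => primitive_idem_idem (prim_b i)) orth_b sum_b.
have haE j := orthogonal_sum j (fun i => primitive_idem_idem (prim_a i)) orth_a sum_a.
pose h (i : 'I_(p + q)) := match split i with inl j => ha j | inr j => hb j end.
have hl j : h (lshift q j) = ha j by rewrite /h (unsplitK (inl j)).
have hr j : h (rshift p j) = hb j by rewrite /h (unsplitK (inr j)).
exists (p + q)%N, h; split.
- by move=> i; rewrite /h; case: (split i).
- move=> i j; rewrite -[i]splitK -[j]splitK.
  case: (split i) (split j) => [i' [] j'|i' [] j'] /=; rewrite ?hl ?hr => ij.
  + by apply: orth_a; apply: contraNneq ij => ->.
  + by rewrite -(haE i').2 -(hbE j').1 mulrA -(mulrA _ a) ab mulr0 mul0r.
  + by rewrite -(hbE i').2 -(haE j').1 mulrA -(mulrA _ b) ba mulr0 mul0r.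
  + by apply: orth_b; apply: contraNneq ij => ->.
- rewrite big_split_ord gE -sum_a -sum_b /=.
  by congr (_ + _); apply: eq_bigr => i _; rewrite ?hl ?hr.
Qed.

(** Over a basic ring 1 - e kills S_e: otherwise some g in a primitive
    decomposition of 1 - e has g R e outside the radical, and then Rg is
    isomorphic to Re. *)
Lemma basic_top_simple (e : R) (y : top_simple e) :
  basic R -> primitive_idem e -> (1 - e) *: y = 0.
Proof.
move=> basicR prim_e; have [ee _ _] := prim_e; have cc := idemC ee.
have [a <-] := quo_surj y; rewrite -linearZ; apply/quo0.
set Re := principal e in a *; pose r : R := incl Re a.
have re : r * e = r by rewrite /r; have [r' _ ->] := inclP a; rewrite -mulrA ee.
suff rad_r : rad_set ((1 - e) * r).
  by exists ((1 - e) * r : R) => //; rewrite -mulrA re.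
have [n [h [prim_h orth_h sum_h]]] := idem_decomposition cc.
have hE i := orthogonal_sum i (fun i => primitive_idem_idem (prim_h i)) orth_h sum_h.
pose h' (i : 'I_n.+1) := if unlift ord0 i is Some j then h j else e.
have h'0 : h' ord0 = e by rewrite /h' unlift_none.
have h'S j : h' (lift ord0 j) = h j by rewrite /h' liftK.
have dec : primitive_decomposition h'.
  split=> [i|i j|].
  - by rewrite /h'; case: unlift.
  - case: (unliftP ord0 i) => [i'|] ->; case: (unliftP ord0 j) => [j'|] ->;
      rewrite ?h'0 ?h'S ?eqxx // => ij.
    + by apply: orth_h; apply: contraNneq ij => ->.
    + by rewrite -(hE i').2 -mulrA mulrBl mul1r ee subrr mulr0.
    + by rewrite -(hE j').1 mulrA mulrBr mulr1 ee subrr mul0r.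
  - rewrite big_ord_recl h'0 (eq_bigr h) => [|j _]; last exact: h'S.
    by rewrite sum_h addrC subrK.
rewrite -sum_h mulr_suml.
elim/big_ind: _ => [||i _]; [exact: rad_set0 | exact: rad_setD |].
apply: contrapT => nrad.
have gx : h i * (h i * r) = h i * r by rewrite mulrA (primitive_idem_idem (prim_h i)).
have xe : h i * r * e = h i * r by rewrite -mulrA re.
have iso := primitive_iso prim_e (prim_h i) gx xe nrad.
have := basicR _ _ dec (lift ord0 i) ord0.
by rewrite h'S h'0 eq_sym neq_lift => /(_ isT); apply.
Qed.

End PrimitiveDecomposition.

(** * Complexes of projectives with cohomology filtered by S_e *)

(** Two presentations of C map to each other, and the two maps compose to the
    identity up to a map into the kernel. *)
Lemma ext_zero_presentation (R : pzRingType) (S C P K : lmodType R)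
    (i : {linear K -> P}) (p : {linear P -> C}) :
  projective P -> ses i p ->
  (forall g : {linear K -> S}, exists h : {linear P -> S}, forall x, h (i x) = g x) ->
  ext_zero S 0 C.
Proof.
move=> projP ip ext P' K' i' p' projP' ip' g.
have [iinj psurj ker_p] := ip; have [iinj' psurj' ker_p'] := ip'.
have [a aE] := projective_ext p projP psurj'.
have [b bE] := projective_ext p' projP' psurj.
have [|a0 a0E] := @factor_inj _ _ _ _ i' (a \o i : {linear K -> P'}) iinj'.
  by move=> x; apply/ker_p'; rewrite /= aE (ses_comp0 _ ip).
have [h hE] := ext (g \o a0).
have lin : linear (fun x => x - a (b x)).
  by move=> c x y; rewrite !linearP /= scalerDr addrACA.
have [|r rE] := @factor_inj _ _ _ _ i' (build_linear lin) iinj'.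
  move=> x; apply/ker_p'; change (p' (x - a (b x)) = 0).
  by rewrite linearB aE bE subrr.
have {}rE x : i' (r x) = x - a (b x) := rE x.
have lin' : linear (fun x => h (b x) + g (r x)).
  by move=> c x y; rewrite !linearP /= scalerDr addrACA.
exists (build_linear lin') => x; change (h (b (i' x)) + g (r (i' x)) = g x).
have [|y yE] := (ker_p (b (i' x))).1; first by rewrite bE (ses_comp0 _ ip').
rewrite -yE hE; change (g (a0 y) + g (r (i' x)) = g x); rewrite -linearD; congr (g _).
apply: iinj'; rewrite linearD rE a0E.
change (a (i y) + (i' x - a (b (i' x))) = i' x).
by rewrite yE addrC subrK.
Qed.

Section Complex.
Variables (R : pzRingType) (e : R).
Hypotheses (rankedR : ranked R^o) (prim_e : primitive_idem e).
Local Notation S_e := (top_simple e).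

Definition fin_pd (M : lmodType R) :=
  exists n, forall S t, (n <= t)%N -> ext_zero S t M.

Variable N : nat.
Hypothesis pd_le_N : forall M : lmodType R, fin_gen M -> fin_pd M ->
  forall S t, (N <= t)%N -> ext_zero S t M.
Hypothesis fin_pd_top : fin_pd S_e.

(** The complex ... -> G (i+1) -> G i -> ... is given through its cokernels C i:
    the differential is the composite of [pi i.+1] and [phi i], and its
    cohomology at i+1 is the kernel of [phi i]. *)
Variables (n : nat) (G C : nat -> lmodType R).
Variables (pi : forall i, {linear G i -> C i}) (phi : forall i, {linear C i.+1 -> G i}).
Hypothesis pi_surj : forall i, surj (pi i).
Hypothesis ker_pi : forall i x, pi i x = 0 <-> exists y, phi i y = x.
Hypothesis fgG : forall i, fin_gen (G i).
Hypothesis projG : forall i, projective (G i).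
Hypothesis hom_G_top : forall i (g : {linear G i -> S_e}) x, g x = 0.
Hypothesis ker_phi_top : forall i x, phi i x = 0 -> (1 - e) *: x = 0.
Hypothesis projCn : projective (C n).

Let nR : noeth R := ranked_noeth rankedR.
Let H i := submod (ker (phi i)).
Let B i := submod (rng (phi i)).

Let fgC i : fin_gen (C i) := fin_gen_surj (@pi_surj i) (fgG i).
Let fgH i : fin_gen (H i) := nR _ (fgC i.+1).
Let fgB i : fin_gen (B i) := nR _ (fgG i).

Let ses_B i : ses (incl (rng (phi i))) (pi i).
Proof.
split; [exact: incl_inj | exact: pi_surj |] => x.
rewrite ker_pi; split=> [|[y <-]]; first exact: (incl_ex (N := rng (phi i))).
exact: (inclP y).
Qed.

Let ses_H i : exists q : {linear C i.+1 -> B i}, ses (incl (ker (phi i))) q.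
Proof.
have [|q qE] := @factor_inj _ _ _ _ (incl (rng (phi i))) (phi i) (@incl_inj _ _ _).
  by move=> x; apply: (incl_ex (N := rng (phi i))); exists x.
exists q; split=> [|y|x]; first exact: incl_inj.
  have [x xy] := inclP y; exists x.
  by apply: (@incl_inj _ _ (rng (phi i))); rewrite qE.
split=> [qx|[y <-]].
  by apply: (incl_ex (N := ker (phi i))); rewrite /= -qE qx linear0.
by apply: (@incl_inj _ _ (rng (phi i))); rewrite qE linear0; exact: (inclP y).
Qed.

Let H_killed i (x : H i) : (1 - e) *: x = 0.
Proof.
apply: (@incl_inj _ _ (ker (phi i))); rewrite linearZ linear0.
by apply: ker_phi_top; exact: (inclP x).
Qed.

Let ext_H i S t : ext_zero S t S_e -> ext_zero S t (H i).
Proof. exact: ext_zero_filtered (@fgH i) (@H_killed i). Qed.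

Let fin_pd_C i : (i <= n)%N -> fin_pd (C i).
Proof.
move=> in_; rewrite -(subKn in_); elim: (n - i)%N (leq_subr i n) => {i in_} [|j IH] jn.
  by rewrite subn0; exists 0%N => S t _; exact: ext_zero_projective.
have [c cE] := IH (ltnW jn); have [d dE] := fin_pd_top.
have E : (n - j = (n - j.+1).+1)%N by rewrite subnSK.
rewrite E in cE; set i := (n - j.+1)%N in cE *; have [q sH] := ses_H i.
exists (maxn c d).+2 => S [|[|t]] //; rewrite !ltnS geq_max => /andP[ct dt].
apply: (ext_zero_quo nR (ses_B i) (fgB i) (fgG i)); last exact: ext_zero_projective.
apply: (ext_zero_quo nR sH (fgH i) (fgC _)); last exact/cE/leqW.
exact/ext_H/dE.
Qed.

Let ext_C i S t : (i <= n)%N -> (N <= t)%N -> ext_zero S t (C i).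
Proof. by move=> in_; exact: pd_le_N (@fgC i) (fin_pd_C in_) S t. Qed.

(** Dimension shifting from C 0, whose Ext vanishes above N, up to B m; each step
    passes through a cohomology module, filtered by S_e. *)
Let ext_B m t : (N <= m.+1)%N ->
  (forall u, (t <= u)%N -> ext_zero S_e u S_e) -> ext_zero S_e t (B m).
Proof.
move=> Nm eS; suff key i : (i <= m)%N -> ext_zero S_e (t + (m - i)) (B i).
  by have := key m (leqnn m); rewrite subnn addn0.
elim: i => [|i IH] im.
  rewrite subn0.
  have e0 : ext_zero S_e (t + m).+1 (C 0%N).
    apply: ext_C => //; apply: (leq_trans Nm).
    by rewrite ltnS leq_addl.
  exact: (e0 _ _ _ _ (@projG 0%N) (ses_B 0%N)).
have [q sH] := ses_H i.
have eC : ext_zero S_e (t + (m - i.+1)).+1 (C i.+1).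
  apply: (ext_zero_mid nR sH (fgH i)).
    by apply/ext_H/eS; rewrite leqW // leq_addr.
  by rewrite -addnS subnSK //; apply/IH/ltnW.
exact: (eC _ _ _ _ (@projG _) (ses_B _)).
Qed.

(** If Ext(C m.+1, S_e) vanishes in all degrees and the cohomology at m.+1 is not
    zero, it contains S_e, and Ext^u(S_e, S_e) = 0 follows for all u by descending
    induction on u, down to the absurd u = 0. *)
Let exact_step m : (N <= m.+1)%N ->
  (forall t, ext_zero S_e t (C m.+1)) -> forall x, phi m x = 0 -> x = 0.
Proof.
move=> Nm eC x phix; apply: contrapT => x0.
have [|j [jinj [z z0]]] := top_simple_embed rankedR prim_e (@fgH m) (@H_killed m).
  have [y yE] := @incl_ex _ _ (ker (phi m)) x phix; exists y => y0.
  by apply: x0; rewrite -yE y0 linear0.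
pose Q := quotmod (rng j); have fgQ : fin_gen Q := fin_gen_surj (@quo_surj _ _ _) (@fgH m).
have sQ : ses j (quo (rng j)).
  by split=> //; [exact: quo_surj | move=> y; rewrite quo0].
have ext_Q S t : ext_zero S t S_e -> ext_zero S t Q.
  apply: ext_zero_filtered => // y; have [w <-] := quo_surj y.
  by rewrite -linearZ H_killed linear0.
have [q sH] := ses_H m.
have ext_S u : ext_zero S_e u S_e.
  have [d dE] := fin_pd_top.
  suff down t : (t <= d)%N -> forall u, (d - t <= u)%N -> ext_zero S_e u S_e.
    by apply: (down d) => //; rewrite subnn.
  elim: t => [|t IH] td v dv; first by apply: dE; rewrite subn0 in dv.
  move: dv; rewrite leq_eqVlt => /orP[/eqP vE|dv]; last first.
    by apply: IH (ltnW td) _ _; rewrite -subnSK.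
  have eS w : (v < w)%N -> ext_zero S_e w S_e.
    by move=> vw; apply: IH (ltnW td) _ _; rewrite -subnSK // vE.
  have eH : ext_zero S_e v (H m).
    exact: (ext_zero_sub nR sH (fgB m) (eC v) (ext_B Nm eS)).
  by apply: (ext_zero_sub nR sQ fgQ eH); apply/ext_Q/eS.
have [h0 h0E] := ext_zero_extend (idfun : {linear S_e -> S_e}) fgQ sQ (ext_Q _ _ (ext_S 0%N)).
have [h1 h1E] := ext_zero_extend h0 (fgB m) sH (ext_B Nm (fun u _ => ext_S u)).
apply: z0; rewrite -[z]h0E -h1E; have [w <-] := pi_surj (incl (ker (phi m)) (j z)).
exact: (hom_G_top (h1 \o pi m.+1 : {linear G m.+1 -> S_e})).
Qed.

Let ses_step m : (forall x, phi m x = 0 -> x = 0) -> ses (phi m) (pi m).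
Proof. by move=> /lin_inj phi_inj; split=> // x; exact: ker_pi. Qed.

(** Descending on m: exactness at m+2 makes C m.+2 the syzygy of C m.+1, so the
    hypothesis of [exact_step] passes from C m.+2 to C m.+1. *)
Let exact_above m : (N <= m.+1)%N -> (m < n)%N -> forall x, phi m x = 0 -> x = 0.
Proof.
move=> Nm mn; apply: exact_step => //.
have [j jE] : exists j, (m.+1 + j = n)%N by exists (n - m.+1)%N; rewrite subnKC.
elim: j m Nm {mn} jE => [|j IH] m Nm jE t.
  by rewrite addn0 in jE; rewrite jE; exact: ext_zero_projective.
have eC : forall t, ext_zero S_e t (C m.+2).
  by apply: IH; [exact: leqW | rewrite addSnnS].
have sm := ses_step (exact_step (leqW Nm) eC).
case: t => [|t].
  apply: ext_zero_presentation (@projG _) sm _ => g.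
  exists (zero_map (G m.+1) S_e) => x; have [w <-] := pi_surj x.
  exact: esym (hom_G_top (g \o pi m.+2 : {linear G m.+2 -> S_e}) w).
apply: (ext_zero_quo nR sm (fgC _) (fgG _) (eC t)).
exact: ext_zero_projective.
Qed.

(** Above N the complex is exact, so it resolves C N.-1, of projective dimension
    at most N. *)
Lemma complex_projective : (0 < N)%N -> ((N + N).-1 <= n)%N -> projective (C (N + N).-1).
Proof.
move=> N0; have <- : (N.-1 + N = (N + N).-1)%N by rewrite -{3}(prednK N0) addSn.
move=> Nn; apply: ext_zero_all_projective => // S.
suff key j : (j <= N)%N -> ext_zero S (N - j) (C (N.-1 + j)).
  by have := key N (leqnn N); rewrite subnn.
elim: j => [|j IH] jN.
  by rewrite subn0 addn0; apply: ext_C => //; apply: leq_trans Nn; exact: leq_addr.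
have sm : ses (phi (N.-1 + j)) (pi (N.-1 + j)).
  apply/ses_step/exact_above; first by rewrite -addSn prednK // leq_addr.
  by apply: leq_trans Nn; rewrite -addnS leq_add2l.
have := IH (ltnW jN); rewrite -subnSK // => eC.
by rewrite addnS; exact: (eC _ _ _ _ (@projG _) sm).
Qed.

End Complex.

(** * Free resolutions given by matrices *)

Section FreeResolution.
Variable A : pzRingType.
Hypothesis noethA : noeth A.

Lemma mulmx_linear m n (D : 'M[A]_(m, n)) : linear (fun v : 'rV[A]_m => v *m D).
Proof. by move=> a u v; rewrite mulmxDl -scalemxAl. Qed.

Definition row_map m n (D : 'M[A]_(m, n)) : {linear 'rV[A]_m -> 'rV[A]_n} :=
  build_linear (mulmx_linear D).

Lemma row_map_ex m n (g : {linear 'rV[A]_m -> 'rV[A]_n}) :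
  exists D, forall v, g v = v *m D.
Proof.
exists (\matrix_i g 'e_i) => v; rewrite {1}(row_sum_delta v) linear_sum mulmx_sum_row.
by apply: eq_bigr => i _; rewrite linearZ rowK.
Qed.

Lemma submod_rows n (U : submodule 'rV[A]_n) :
  exists m (D : 'M[A]_(m, n)), forall v, U v <-> exists w, w *m D = v.
Proof.
have [m [p psurj]] := fin_gen_cover (noethA U (@fin_gen_free A n)).
have [D DE] := row_map_ex (incl U \o p : {linear 'rV[A]_m -> 'rV[A]_n}).
exists m, D => v; split=> [/incl_ex[y <-]|[w <-]].
  by have [w <-] := psurj y; exists w; rewrite -DE.
by rewrite -DE; exact: inclP.
Qed.

Record stage := Stage { cols : nat; rows : nat; mx : 'M[A]_(rows, cols) }.

(** The dimensions are chosen so that the number of columns at each stage is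
    convertible to the number of rows at the previous one. *)
Lemma free_resolution (M : lmodType A) : fin_gen M ->
  exists (c : nat -> nat) (D : forall i, 'M[A]_(c i.+1, c i))
    (eps : {linear 'rV[A]_(c 0%N) -> M}),
  [/\ surj eps, forall v, eps v = 0 <-> exists w : 'rV_(c 1%N), w *m D 0%N = v
    & forall i (v : 'rV_(c i.+1)),
        v *m D i = 0 <-> exists w : 'rV_(c i.+2), w *m D i.+1 = v].
Proof.
move=> /fin_gen_cover[c0 [eps eps_surj]].
have [c1 [D0 D0E]] := submod_rows (ker eps).
have next_ex (s : stage) : exists n (D : 'M[A]_(n, rows s)),
    forall v : 'rV_(rows s), v *m mx s = 0 <-> exists w : 'rV_n, w *m D = v.
  have [n [D DE]] := submod_rows (ker (row_map (mx s))).
  by exists n, D => v; exact: DE.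
pose nrows s := projT1 (cid (next_ex s)).
pose nmx s : 'M[A]_(nrows s, rows s) := projT1 (cid (projT2 (cid (next_ex s)))).
have nmxE s (v : 'rV_(rows s)) :
    v *m mx s = 0 <-> exists w : 'rV_(nrows s), w *m nmx s = v.
  exact: projT2 (cid (projT2 (cid (next_ex s)))) v.
pose st := fix st i := if i is j.+1 then Stage (nmx (st j)) else Stage D0.
by exists (fun i => cols (st i)), (fun i => mx (st i)), eps; split.
Qed.

End FreeResolution.

(** * From a corner ring to the ring *)

Section Corner.
Variables (R : pzRingType) (f : R) (hf : idem f).
Local Notation A := (corner hf).
Hypotheses (noethR : noeth R) (noethA : noeth A).

Definition up m n (D : 'M[A]_(m, n)) : 'M[R]_(m, n) := map_mx (@corner_val R f) D.

Lemma corner_val_sum (I : finType) (F : I -> A) :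
  corner_val (\sum_i F i) = \sum_i corner_val (F i).
Proof. by elim/big_rec2: _ => // i x y _ <-. Qed.

Lemma upM m n p (D : 'M[A]_(m, n)) (E : 'M[A]_(n, p)) : up (D *m E) = up D *m up E.
Proof.
apply/matrixP => i j; rewrite !mxE corner_val_sum.
by apply: eq_bigr => k _; rewrite !mxE.
Qed.

Lemma up_inj m n : injective (@up m n).
Proof.
move=> D E DE; apply/matrixP => i j; apply: val_inj.
by have := congr1 (fun X : 'M_(m, n) => X i j) DE; rewrite !mxE.
Qed.

(** The module (Rf)^n, which is the free module of rank n over the corner ring
    tensored with Rf. *)
Definition corner_rows n : submodule 'rV[R]_n.
Proof.
exists (fun v : 'rV[R]_n => forall j, v 0 j * f = v 0 j).
- by move=> j; rewrite mxE mul0r.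
- by move=> u v uf vf j; rewrite mxE mulrDl uf vf.
- by move=> a v vf j; rewrite mxE -mulrA vf.
Defined.

Local Notation G n := (submod (corner_rows n)).

Lemma corner_rows_up n (w : 'rV[A]_n) : corner_rows n (up w).
Proof. by move=> j; rewrite mxE corner_mulr. Qed.

Lemma corner_rows_proj n : exists r : {linear 'rV[R]_n -> G n},
  forall v, incl (corner_rows n) (r v) = \row_j (v 0 j * f).
Proof.
have lin : linear (fun v : 'rV[R]_n => \row_j (v 0 j * f)).
  by move=> a u v; apply/rowP => j; rewrite !mxE mulrDl mulrA.
have [|r rE] := @factor_inj _ _ _ _ (incl (corner_rows n)) (build_linear lin)
    (@incl_inj _ _ _).
  move=> v; apply: (incl_ex (N := corner_rows n)) => j.
  by rewrite /build_linear mxE -mulrA hf.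
by exists r.
Qed.

Lemma corner_rows_projK n (r : {linear 'rV[R]_n -> G n}) :
  (forall v, incl (corner_rows n) (r v) = \row_j (v 0 j * f)) ->
  forall x, r (incl (corner_rows n) x) = x.
Proof.
move=> rE x; apply: (@incl_inj _ _ (corner_rows n)); rewrite rE.
by apply/rowP => j; rewrite mxE; exact: (inclP x).
Qed.

Lemma corner_rows_projective n : projective (G n).
Proof.
have [r rE] := corner_rows_proj n.
exact: projective_retract (corner_rows_projK rE) (@projective_free R n).
Qed.

Lemma corner_rows_fin_gen n : fin_gen (G n).
Proof. exact: noethR (@fin_gen_free R n). Qed.

(** (Rf)^n is generated by elements fixed by f. *)
Lemma corner_rows_hom0 n (S : lmodType R) (g : {linear G n -> S}) :
  (forall y : S, f *: y = 0) -> forall x, g x = 0.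
Proof.
move=> fS x; have [r rE] := corner_rows_proj n.
have re j : r 'e_j = f *: r 'e_j.
  apply: (@incl_inj _ _ (corner_rows n)); rewrite linearZ rE.
  apply/rowP => k; rewrite !mxE; case: (_ && _); last by rewrite mul0r mulr0.
  by rewrite mul1r hf.
rewrite -(corner_rows_projK rE x) (row_sum_delta (incl _ x)) !linear_sum big1 // => j _.
by rewrite !linearZ /= re linearZ /= fS scaler0.
Qed.

Lemma corner_rows_up1 n (v : 'rV[R]_n) : corner_rows n v -> v *m up 1%:M = v.
Proof.
move=> vf; apply/rowP => j; rewrite mxE (bigD1 j) //= big1 => [|i ij].
  by rewrite !mxE eqxx addr0 vf.
by rewrite !mxE (negPf ij) mulr0.
Qed.

Section Differential.
Variables (m n : nat) (D : 'M[A]_(m, n)).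

Lemma corner_rows_mul (v : 'rV[R]_m) : corner_rows n (v *m up D).
Proof.
move=> j; rewrite mxE mulr_suml; apply: eq_bigr => k _.
by rewrite -mulrA mxE corner_mulr.
Qed.

Lemma up0 : up (0 : 'M[A]_(m, n)) = 0.
Proof. by apply/matrixP => i j; rewrite !mxE. Qed.

Lemma upB (E : 'M[A]_(m, n)) : up (D - E) = up D - up E.
Proof. by apply/matrixP => i j; rewrite !mxE. Qed.

Lemma corner_map_ex : exists d : {linear G m -> G n},
  forall x, incl (corner_rows n) (d x) = incl (corner_rows m) x *m up D.
Proof.
have [|d dE] := @factor_inj _ _ _ _ (incl (corner_rows n))
   (row_map (up D) \o incl (corner_rows m) : {linear G m -> _}) (@incl_inj _ _ _).
  by move=> x; apply: (incl_ex (N := corner_rows n)); exact: corner_rows_mul.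
by exists d.
Qed.

Definition corner_map : {linear G m -> G n} := projT1 (cid corner_map_ex).

Lemma corner_mapE x : incl (corner_rows n) (corner_map x) = incl (corner_rows m) x *m up D.
Proof. exact: projT2 (cid corner_map_ex) x. Qed.

End Differential.

Lemma corner_rows_down n (x : G n) :
  exists w : 'rV[A]_n, incl (corner_rows n) (f *: x) = up w.
Proof.
exists (\row_j to_corner hf (incl (corner_rows n) x 0 j)); apply/rowP => j.
by rewrite !mxE /= -mulrA (inclP x).
Qed.

Lemma up_fixed n (w : 'rV[A]_n) : f *: up w = up w.
Proof. by apply/rowP => j; rewrite !mxE corner_mull. Qed.

Lemma up_inclP n (w : 'rV[A]_n) : exists x : G n, incl (corner_rows n) x = up w.
Proof. exact/incl_ex/corner_rows_up. Qed.

(** A splitting over the corner ring is given by matrices E and T with D E = 0 and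
    1 - E = T D, and these also act on row vectors over Rf. *)
Lemma corner_coker_projective m n (D : 'M[A]_(m, n)) :
  projective (quotmod (rng (row_map D))) -> projective (quotmod (rng (corner_map D))).
Proof.
set U := rng (row_map D); set V := rng (corner_map D) => projU.
have [s sE] := projective_ext (idfun : {linear quotmod U -> _}) projU (@quo_surj _ _ U).
have [E EE] := row_map_ex (s \o quo U : {linear 'rV[A]_n -> _}).
have {}EE v : s (quo U v) = v *m E := EE v.
have DE : D *m E = 0.
  apply/row_matrixP => i; rewrite row_mul -EE row0.
  have -> : quo U (row i D) = 0; last by rewrite linear0.
  by apply/quo0; exists ('e_i); exact: (esym (rowE i D)).
have [T TE] : exists T, 1%:M - E = T *m D.
  have rowU i : exists w, w *m D = row i (1%:M - E).
    have : quo U (row i (1%:M - E)) = 0; last by move/quo0 => [w wE]; exists w.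
    have -> : row i (1%:M - E) = row i 1%:M - row i 1%:M *m E.
      by rewrite -row_mul mul1mx linearB.
    by rewrite linearB -EE sE subrr.
  exists (\matrix_i projT1 (cid (rowU i))); apply/row_matrixP => i.
  by rewrite row_mul rowK; case: cid.
have killE x : corner_map E (corner_map D x) = 0.
  apply: (@incl_inj _ _ (corner_rows n)).
  rewrite !corner_mapE linear0 -mulmxA -upM DE.
  by rewrite up0 mulmx0.
have [y|h hE] := @factor_surj _ _ _ _ (quo V) (corner_map E) (@quo_surj _ _ V).
  by move=> /quo0[x <-]; exact: killE.
apply: (projective_retract (i := h) (r := quo V)) (@corner_rows_projective n) => y.
have [x <-] := quo_surj y; rewrite hE; apply/eqP; rewrite -subr_eq0 -linearB; apply/eqP.
apply/quo0; exists (- corner_map T x); apply: (@incl_inj _ _ (corner_rows n)).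
rewrite !linearN linearB !corner_mapE -mulmxA -upM -TE upB mulmxBr.
by rewrite (corner_rows_up1 (inclP x)) opprB.
Qed.

(** The f-part of a splitting over R is a splitting over the corner ring. *)
Lemma coker_corner_projective m n (D : 'M[A]_(m, n)) :
  projective (quotmod (rng (corner_map D))) -> projective (quotmod (rng (row_map D))).
Proof.
set U := rng (row_map D); set V := rng (corner_map D) => projV.
have [s sE] := projective_ext (idfun : {linear quotmod V -> _}) projV (@quo_surj _ _ V).
pose down (w : 'rV[A]_n) : G n := projT1 (cid (up_inclP w)).
have downE w : incl (corner_rows n) (down w) = up w by rewrite /down; case: cid.
have down_fixed w : f *: down w = down w.
  by apply: (@incl_inj _ _ (corner_rows n)); rewrite linearZ downE; exact: up_fixed.
(* The section s, lifted to row vectors and restricted to f-parts. *)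
pose split_ (w : 'rV[A]_n) := s (quo V (down w)).
have split_fixed w : f *: split_ w = split_ w by rewrite /split_ -!linearZ down_fixed.
have t_ex w : exists z : 'rV[A]_n, up z = incl (corner_rows n) (split_ w).
  by have [z zE] := corner_rows_down (split_ w); exists z; rewrite -zE split_fixed.
pose t w := projT1 (cid (t_ex w)).
have tE w : up (t w) = incl (corner_rows n) (split_ w) by rewrite /t; case: cid.
have down_linear a u v : down (a *: u + v) = corner_val a *: down u + down v.
  apply: (@incl_inj _ _ (corner_rows n)); rewrite linearP !downE.
  by apply/rowP => j; rewrite !mxE.
have lin : linear t.
  move=> a u v; apply: up_inj; rewrite tE /split_ down_linear !linearP -!tE.
  by apply/rowP => j; rewrite !mxE.
have [y|h hE] := @factor_surj _ _ _ _ (quo U) (build_linear lin) (@quo_surj _ _ U).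
  move=> /quo0[w <-]; apply: up_inj; rewrite up0; change (up (t (w *m D)) = 0).
  rewrite tE /split_ (_ : quo V _ = 0) ?linear0 //; apply/quo0.
  have [x xE] := up_inclP w; exists x.
  by apply: (@incl_inj _ _ (corner_rows n)); rewrite corner_mapE xE downE -upM.
apply: (projective_retract (i := h) (r := quo U)) (@projective_free A n) => y.
have [w <-] := quo_surj y; rewrite hE; apply/eqP; rewrite -subr_eq0 -linearB; apply/eqP.
apply/quo0.
have /quo0[x xE] : quo V (split_ w - down w) = 0 by rewrite linearB sE subrr.
have [u uE] := corner_rows_down x.
exists u; apply: up_inj; change (up (u *m D) = up (t w - w)).
rewrite upM -uE linearZ -scalemxAl -corner_mapE xE upB tE -downE -linearB -linearZ.
by rewrite scalerBr split_fixed down_fixed.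
Qed.

Section Complex.
Variables (c : nat -> nat) (D : forall i, 'M[A]_(c i.+1, c i)).
Hypothesis exactD : forall i (v : 'rV_(c i.+1)),
  v *m D i = 0 <-> exists w : 'rV_(c i.+2), w *m D i.+1 = v.

Lemma complex0 i : D i.+1 *m D i = 0.
Proof.
apply/row_matrixP => j; rewrite row_mul row0; apply/exactD.
by exists 'e_j; rewrite -rowE.
Qed.

Definition coker i : lmodType R := quotmod (rng (corner_map (D i))).

Definition coker_pi i : {linear G (c i) -> coker i} := quo (rng (corner_map (D i))).

Lemma corner_map_comp0 i x : corner_map (D i) (corner_map (D i.+1) x) = 0.
Proof.
apply: (@incl_inj _ _ (corner_rows _)); rewrite !corner_mapE linear0.
by rewrite -mulmxA -upM complex0 up0 mulmx0.
Qed.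

Lemma coker_phi_ex i : exists phi : {linear coker i.+1 -> G (c i)},
  forall x, phi (coker_pi i.+1 x) = corner_map (D i) x.
Proof.
apply: factor_surj; first exact: quo_surj.
by move=> x /quo0[y <-]; exact: corner_map_comp0.
Qed.

Definition coker_phi i : {linear coker i.+1 -> G (c i)} := projT1 (cid (coker_phi_ex i)).

Lemma coker_phiE i x : coker_phi i (coker_pi i.+1 x) = corner_map (D i) x.
Proof. exact: projT2 (cid (coker_phi_ex i)) x. Qed.

Lemma ker_coker_pi i x : coker_pi i x = 0 <-> exists y, coker_phi i y = x.
Proof.
rewrite quo0; split=> [[y <-]|[y <-]].
  by exists (coker_pi i.+1 y); rewrite coker_phiE.
by have [x' <-] := quo_surj y; exists x'; rewrite -coker_phiE.
Qed.

(** Multiplication by f turns a cycle over R into a cycle over the corner ring,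
    hence into a boundary. *)
Lemma ker_coker_phi i x : coker_phi i x = 0 -> f *: x = 0.
Proof.
have [y <-] := quo_surj x; rewrite -linearZ [coker_phi i _]coker_phiE => Dy.
have [w wE] := corner_rows_down y.
have /exactD[u uE] : w *m D i = 0.
  apply: up_inj; rewrite upM -wE up0 linearZ -scalemxAl -corner_mapE Dy.
  by rewrite linear0 scaler0.
have [z zE] := up_inclP u; apply/quo0; exists z.
by apply: (@incl_inj _ _ (corner_rows _)); rewrite corner_mapE zE -upM uE wE.
Qed.

(** The module itself for i = 0, and its i-th syzygy in general. *)
Definition syzygy i : lmodType A := quotmod (rng (row_map (D i))).

Lemma syzygy_ses i : exists (k : {linear syzygy i.+1 -> 'rV[A]_(c i)})
  (p : {linear 'rV[A]_(c i) -> syzygy i}), ses k p.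
Proof.
have [x|k kE] := @factor_surj _ _ _ _ (quo (rng (row_map (D i.+1)))) (row_map (D i))
    (@quo_surj _ _ _).
  by move=> /quo0[y <-]; apply/exactD; exists y.
exists k, (quo _); split=> [||x]; [|exact: quo_surj|].
- apply: lin_inj => y; have [x <-] := quo_surj y; rewrite kE => Dx.
  by apply/quo0; have /exactD[w wE] : x *m D i = 0 := Dx; exists w.
- rewrite quo0; split=> [[y <-]|[y <-]]; first by exists (quo _ y); rewrite kE.
  by have [z <-] := quo_surj y; rewrite kE; exists z.
Qed.

Lemma ext_zero_syzygy S t i : ext_zero S (t + i) (syzygy 0) -> ext_zero S t (syzygy i).
Proof.
elim: i t => [|i IH] t; first by rewrite addn0.
rewrite addnS -addSn => /IH eS; have [k [p kp]] := syzygy_ses i.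
exact: (eS _ _ _ _ (@projective_free A _) kp).
Qed.

Lemma syzygy_fin_gen i : fin_gen (syzygy i).
Proof. exact: fin_gen_surj (@quo_surj _ _ _) (@fin_gen_free A _). Qed.

Lemma syzygy_projective_ext S i :
  projective (syzygy i) -> ext_zero S i (syzygy 0).
Proof.
move=> proj_i; suff key j : (j <= i)%N -> ext_zero S j (syzygy (i - j)).
  by have := key i (leqnn i); rewrite subnn.
elim: j => [|j IH] ji; first by rewrite subn0; exact: ext_zero_projective.
have := IH (ltnW ji); rewrite -subnSK // => eS.
have [k [p kp]] := syzygy_ses (i - j.+1).
apply: (ext_zero_quo noethA kp (syzygy_fin_gen _) (@fin_gen_free A _) eS).
by apply: ext_zero_projective; exact: projective_free.
Qed.

End Complex.

End Corner.

(** * The finitistic dimension of the corner ring *)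

Section CornerBound.
Variables (R : pzRingType) (e : R) (N : nat).
Hypotheses (rankedR : ranked R^o) (prim_e : primitive_idem e) (hf : idem (1 - e)).
Hypothesis N_gt0 : (0 < N)%N.
Hypothesis pd_le_N : forall M : lmodType R, fin_gen M -> fin_pd M ->
  forall S t, (N <= t)%N -> ext_zero S t M.
Hypothesis fin_pd_top : fin_pd (top_simple e).
Hypothesis top_killed : forall y : top_simple e, (1 - e) *: y = 0.

Lemma corner_resolution (M : lmodType (corner hf)) n :
  fin_gen M -> proj_resolution M n -> proj_resolution M (N + N).-1.
Proof.
have noethR := ranked_noeth rankedR.
have noethA := ranked_noeth (corner_ranked hf rankedR).
move=> fgM Mn; apply: ext_zero_resolution => // S.
have [le_n|/ltnW lt_n] := leqP n (N + N).-1; first exact: resolution_ext_zero Mn le_n.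
have [c [D [eps [eps_surj ker_eps exactD]]]] := free_resolution noethA fgM.
have [v|h hE] := @factor_surj _ _ _ _ (quo (rng (row_map (D 0%N)))) eps (@quo_surj _ _ _).
  by move=> /quo0[w <-]; apply/ker_eps; exists w.
have bij_h : bijective h.
  apply: inj_surj_bij => [|x].
    apply: lin_inj => y; have [v <-] := quo_surj y; rewrite hE => /ker_eps[w <-].
    by apply/quo0; exists w.
  by have [v <-] := eps_surj x; exists (quo _ v).
apply: (ext_zero_iso bij_h); apply: (syzygy_projective_ext noethA exactD).
apply: coker_corner_projective.
have projYn : projective (syzygy D n).
  apply: ext_zero_all_projective => [|S']; first exact: syzygy_fin_gen.
  apply: (ext_zero_syzygy exactD); rewrite add0n.
  have [x|h' h'E] := @factor_inj _ _ _ _ h (idfun : {linear M -> M}) (bij_inj bij_h).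
    by have [h0 _ h0K] := bij_h; exists (h0 x); rewrite h0K.
  apply: (@ext_zero_iso _ _ _ _ _ h'); last exact: resolution_ext_zero Mn (leqnn n).
  by exists h => x; [exact: h'E | apply: (bij_inj bij_h); rewrite h'E].
have projCn := corner_coker_projective projYn.
apply: (complex_projective rankedR prim_e pd_le_N fin_pd_top
  (pi := coker_pi D) (phi := coker_phi exactD)) projCn _ _.
- by move=> i; exact: quo_surj.
- exact: ker_coker_pi.
- by move=> i; exact: corner_rows_fin_gen.
- by move=> i; exact: corner_rows_projective.
- by move=> i g; apply: corner_rows_hom0.
- by move=> i x; exact: ker_coker_phi.
- exact: N_gt0.
- exact: lt_n.
Qed.

End CornerBound.

Theorem theorem1p1 (k : comNzRingType) (L : algType k)
    (hArtin : artin_algebra L) (hbasic : basic L)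
    (e : L) (he : primitive_idem e)
    (hpd : (pd (top_simple e) < +oo)%E)
    (hpd_ge1 : (1%:E <= pd (top_simple e))%E) :
  exists l : int,
    [/\ (1%:E <= l%:E)%E, (l%:E <= pd (top_simple e))%E &
        (findim (corner (idemC (primitive_idem_idem he)))
           <= 2%:E * findim L - l%:E)%E].
Proof.
have rankedL := artin_algebra_ranked hArtin.
have noethL := ranked_noeth rankedL.
exists 1; split=> //.
have [->|[N [-> pd_N]]] := findim_cases L; first by rewrite gt0_muley // leey.
have fgS := fin_gen_top_simple rankedL e.
have N_gt0 : (0 < N)%N.
  by have := le_trans hpd_ge1 (pd_N _ fgS hpd); rewrite (lee_nat 1).
have fin_pd_top : fin_pd (top_simple e).
  by have [d [_ Sd]] := pd_fin hpd; exists d => S t; exact: resolution_ext_zero Sd.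
have pd_le_N (M : lmodType L) : fin_gen M -> fin_pd M ->
    forall S t, (N <= t)%N -> ext_zero S t M.
  move=> fgM [n nE] S t Nt.
  have Mn := ext_zero_resolution noethL fgM (fun S => nE S n (leqnn n)).
  have fM : (pd M < +oo)%E by apply: le_lt_trans (pd_le Mn) (ltry _).
  have [m [mE Mm]] := pd_fin fM; apply: resolution_ext_zero Mm _ => //.
  by apply: leq_trans Nt; rewrite -lee_nat -mE pd_N.
have top_killed (y : top_simple e) := basic_top_simple rankedL y hbasic he.
have -> : (2%:E * N%:Z%:E - 1%:E = (N + N).-1%:Z%:E :> \bar int)%E.
  rewrite -EFinM -EFinB; congr EFin; rewrite predn_int ?addn_gt0 ?N_gt0 //.
  by rewrite PoszD mulrDl mul1r.
apply: findim_le => M fgM /pd_fin[n [_ Mn]]; apply: pd_le.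
exact: corner_resolution rankedL he _ N_gt0 pd_le_N fin_pd_top top_killed _ _ fgM Mn.
Qed.
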